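(* Let $R$ be a commutative ring with $1_R\neq0_R$, let $(C,\Delta_C,\varepsilon_C)$ be a counital coassociative $R$-coalgebra with opposite dual algebra $C^{\bullet}=(C^{\ast})^{op}$, and consider the $R$-linear morphism $\eta_{C^{\bullet}}:R\to C^{\bullet}$, $r\mapsto[c\mapsto r\varepsilon_C(c)]$. 1. $\mathbf{C}:=(\mathbf{C}:C^{\bullet})$ is a (not necessarily counital) $C^{\bullet}$-coring, where $\mathbf{C}=C$ with its canonical $(C^{\bullet},C^{\bullet})$-bimodule structure, and with comultiplication $$\Delta_{\mathbf{C}}:\mathbf{C}\to\mathbf{C}\otimes_{C^{\bullet}}\mathbf{C},\quad c\mapsto\sum c_1\otimes_{C^{\bullet}}c_2,$$ the composite of $\Delta_C$ with the canonical map $C\otimes_RC\to C\otimes_{C^{\bullet}}C$. Moreover, $(\mathrm{id}:\eta_{C^{\bullet}}):(C:R)\to(\mathbf{C}:C^{\bullet})$ is a morphism of corings. 2. $\widehat{\mathbf{C}}:=\mathbf{C}\times C^{\bullet}$ is a counital $C^{\bullet}$-coring with canonical $(C^{\bullet},C^{\bullet})$-bimodule structure, and with comultiplication and counit $$\Delta_{\widehat{\mathbf{C}}}(c,f)=\sum(c_1,0)\otimes_{C^{\bullet}}(c_2,0)+(0,\varepsilon_C)\otimes_{C^{\bullet}}(c,f)+(c,f)\otimes_{C^{\bullet}}(0,\varepsilon_C)-(0,f)\otimes_{C^{\bullet}}(0,\varepsilon_C),\qquad\varepsilon_{\widehat{\mathbf{C}}}(c,f)=f.$$ 3. The category of not necessarily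 counital right (left) $\mathbf{C}$-comodules is isomorphic to the category of counital right (left) $\widehat{\mathbf{C}}$-comodules. 4. If $D$ is any (counital) $R$-coalgebra and $(\mathbf{D}:D^{\bullet})$ is the corresponding $D^{\bullet}$-coring, where $D^{\bullet}=D^{\ast op}$, then the category of not necessarily counital $(\mathbf{D},\mathbf{C})$-bicomodules is isomorphic to the category of counital $(\widehat{\mathbf{D}},\widehat{\mathbf{C}})$-bicomodules, where $\widehat{\mathbf{D}}=\mathbf{D}\times D^{\bullet}$ is the counital $D^{\bullet}$-coring constructed from $\mathbf{D}$ as in item 2.
   Context: Sweedler notation $\Delta_C(c)=\sum c_1\otimes_Rc_2$ is used. $C^{\ast}=\mathrm{Hom}_R(C,R)$ has the product $(f\ast g)(c)=\sum f(c_1)g(c_2)$; $C^{\bullet}:=(C^{\ast})^{op}$, i.e. $(f\bullet g)(c)=\sum g(c_1)f(c_2)$, with unit $\varepsilon_C$. The canonical $(C^{\bullet},C^{\bullet})$-bimodule structure on $C$ is $f\rightharpoondown c:=\sum f(c_1)c_2$, $c\leftharpoondown g:=\sum c_1g(c_2)$. The canonical bimodule structure on $\mathbf{C}\times C^{\bullet}$ is $f'(c,f)f'':=(f'\rightharpoondown c\leftharpoondown f'',\,f'\bullet f\bullet f'')$. Corings: let $A,B$ be unital $R$-algebras. A (not necessarily counital) $A$-coring is an $(A,A)$-bimodule $\mathcal{C}$ with an $(A,A)$-bilinear map $\Delta_{\mathcal{C}}:\mathcal{C}\to\mathcal{C}\otimes_A\mathcal{C}$ such that $(\Delta_{\mathcal{C}}\otimes_A\mathrm{id})\circ\Delta_{\mathcal{C}}=(\mathrm{id}\otimes_A\Delta_{\mathcal{C}})\circ\Delta_{\mathcal{C}}$.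 It is counital iff there is an $(A,A)$-bilinear map $\varepsilon_{\mathcal{C}}:\mathcal{C}\to A$ with $\sum\varepsilon_{\mathcal{C}}(c_1)c_2=c=\sum c_1\varepsilon_{\mathcal{C}}(c_2)$ for all $c$. An $R$-coalgebra is an $R$-coring with $rc=cr$ for all $r\in R$, $c\in C$. A morphism of (not necessarily counital) corings $(\theta:\gamma):(\mathcal{C}:A)\to(\mathcal{D}:B)$ is a morphism of unital $R$-algebras $\gamma:A\to B$ together with an $(A,A)$-bilinear map $\theta:\mathcal{C}\to\mathcal{D}$ ($\mathcal{D}$ being an $(A,A)$-bimodule via $\gamma$) with $\chi\circ(\theta\otimes_A\theta)\circ\Delta_{\mathcal{C}}=\Delta_{\mathcal{D}}\circ\theta$, where $\chi:\mathcal{D}\otimes_A\mathcal{D}\to\mathcal{D}\otimes_B\mathcal{D}$ is the canonical map. Comodules: a (not necessarily counital) right $\mathcal{C}$-comodule over an $A$-coring $\mathcal{C}$ is a right $A$-module $M$ with a right $A$-linear map $\varrho_M:M\to M\otimes_A\mathcal{C}$, $m\mapsto\sum m_{<0>}\otimes_Am_{<1>}$, such that $(\mathrm{id}_M\otimes_A\Delta_{\mathcal{C}})\circ\varrho_M=(\varrho_M\otimes_A\mathrm{id}_{\mathcal{C}})\circ\varrho_M$; if $\mathcal{C}$ is counital, $M$ is counital iff $\sum m_{<0>}\varepsilon_{\mathcal{C}}(m_{<1>})=m$ for all $m$. Morphisms are the $A$-linear maps $f:M\to N$ with $\varrho_N\circ f=(f\otimes_A\mathrm{id}_{\mathcal{C}})\circ\varrho_M$.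 Left comodules are defined symmetrically. For a $B$-coring $\mathcal{D}$ and an $A$-coring $\mathcal{C}$, a $(\mathcal{D},\mathcal{C})$-bicomodule is a $(B,A)$-bimodule $M$ that is a left $\mathcal{D}$-comodule via $\varrho^{\mathcal{D}}_M:M\to\mathcal{D}\otimes_BM$ and a right $\mathcal{C}$-comodule via $\varrho^{\mathcal{C}}_M:M\to M\otimes_A\mathcal{C}$, such that $\varrho^{\mathcal{D}}_M$ is right $\mathcal{C}$-colinear (equivalently $\varrho^{\mathcal{C}}_M$ is left $\mathcal{D}$-colinear), i.e. $(\varrho^{\mathcal{D}}_M\otimes_A\mathrm{id}_{\mathcal{C}})\circ\varrho^{\mathcal{C}}_M=(\mathrm{id}_{\mathcal{D}}\otimes_B\varrho^{\mathcal{C}}_M)\circ\varrho^{\mathcal{D}}_M$; it is counital iff it is counital on both sides; morphisms are the $(B,A)$-bilinear maps that are left $\mathcal{D}$-colinear and right $\mathcal{C}$-colinear. *)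

(* Defs.v *)
From HB Require Import structures.
From mathcomp Require Import all_boot all_algebra.
From mathcomp Require Import generic_quotient.
From mathcomp Require Import boolp.

Set Implicit Arguments.
Unset Strict Implicit.
Unset Printing Implicit Defensive.

Import GRing.Theory.
Local Open Scope ring_scope.
Local Open Scope quotient_scope.

(* All rings are unital but possibly trivial (pzRingType): the dual algebra of
   the zero coalgebra is the zero ring.  All modules are unital.  Left modules
   are the library's lmodType; right modules and bimodules are added here. *)

HB.mixin Record Zmodule_isRmodule (A : pzRingType) M of GRing.Zmodule M := {
  ract : M -> A -> M;
  ractA_subproof : forall m a b, ract (ract m a) b = ract m (a * b);
  ract1_subproof : forall m, ract m 1 = m;
  ractDl_subproof : forall a, {morph ract^~ a : x y / x + y};
  ractDr_subproof : forall m, {morph ract m : a b / a + b}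
}.

#[short(type="rmodType")]
HB.structure Definition Rmodule (A : pzRingType) :=
  {M of GRing.Zmodule M & Zmodule_isRmodule A M}.

Notation "m :* a" := (ract m a) : ring_scope.

HB.mixin Record isBimodule (A B : pzRingType) M
    of GRing.Lmodule A M & Rmodule B M := {
  bimodA_subproof : forall (a : A) (m : M) (b : B), (a *: m) :* b = a *: (m :* b)
}.

#[short(type="bimodType")]
HB.structure Definition Bimodule (A B : pzRingType) :=
  {M of GRing.Lmodule A M & Rmodule B M & isBimodule A B M}.

Section RmoduleTheory.
Variables (A : pzRingType) (M : rmodType A).
Implicit Types (m : M) (a : A).

Lemma ractA m a b : m :* a :* b = m :* (a * b).
Proof. exact: ractA_subproof. Qed.
Lemma ract1 m : m :* (1 : A) = m.
Proof. exact: ract1_subproof. Qed.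
Lemma ractDl a m m' : (m + m') :* a = m :* a + m' :* a.
Proof. exact: ractDl_subproof. Qed.
Lemma ractDr m a b : m :* (a + b) = m :* a + m :* b.
Proof. exact: ractDr_subproof. Qed.
End RmoduleTheory.

Lemma bimodA (A B : pzRingType) (M : bimodType A B) (a : A) (m : M) (b : B) :
  (a *: m) :* b = a *: (m :* b).
Proof. exact: bimodA_subproof. Qed.

Definition rlinear (A : pzRingType) (M N : rmodType A) (f : M -> N) : Prop :=
  forall (a : A) (x y : M), f (x :* a + y) = f x :* a + f y.

Definition bimod_linear (A B : pzRingType) (M N : bimodType A B)
    (f : M -> N) : Prop :=
  linear f /\ rlinear f.

Section RegularBimodule.
Variable A : pzRingType.
HB.instance Definition _ := Zmodule_isRmodule.Build A A^o
  (fun x y z : A => esym (mulrA x y z)) (@mulr1 A)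
  (fun (a x y : A) => mulrDl x y a) (@mulrDr A).
HB.instance Definition _ := isBimodule.Build A A A^o
  (fun x y z : A => esym (mulrA x y z)).
End RegularBimodule.

Section PairRmodule.
Variables (A : pzRingType) (M N : rmodType A).
Definition pair_ract (x : M * N) (a : A) : M * N := (x.1 :* a, x.2 :* a).
Fact pair_ractA x a b : pair_ract (pair_ract x a) b = pair_ract x (a * b).
Proof. by rewrite /pair_ract /= !ractA. Qed.
Fact pair_ract1 x : pair_ract x 1 = x.
Proof. by case: x => m n; rewrite /pair_ract /= !ract1. Qed.
Fact pair_ractDl a : {morph pair_ract^~ a : x y / x + y}.
Proof. by move=> x y; rewrite /pair_ract /= !ractDl. Qed.
Fact pair_ractDr x : {morph pair_ract x : a b / a + b}.
Proof. by move=> a b; rewrite /pair_ract /= !ractDr. Qed.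
HB.instance Definition _ := Zmodule_isRmodule.Build A (M * N)%type
  pair_ractA pair_ract1 pair_ractDl pair_ractDr.
End PairRmodule.

Section PairBimodule.
Variables (A B : pzRingType) (M N : bimodType A B).
Fact pair_bimodA (a : A) (x : M * N) (b : B) : (a *: x) :* b = a *: (x :* b).
Proof. by case: x => m n; congr (_, _); rewrite /= bimodA. Qed.
HB.instance Definition _ := isBimodule.Build A B (M * N)%type pair_bimodA.
End PairBimodule.

Definition balanced (A : pzRingType) (M : rmodType A) (N : lmodType A)
    (Z : zmodType) (h : M -> N -> Z) : Prop :=
  [/\ forall m m' n, h (m + m') n = h m n + h m' n,
      forall m n n', h m (n + n') = h m n + h m n' &
      forall m a n, h (m :* a) n = h m (a *: n)].

Section Tensor.
Variables (A : pzRingType) (M : rmodType A) (N : lmodType A).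

(* Formal sums of pairs, read off through h; opposites need no separate sign,
   since - (m, n) is represented by (- m, n). *)
Definition fsum (Z : zmodType) (h : M -> N -> Z) (s : seq (M * N)) : Z :=
  \sum_(p <- s) h p.1 p.2.

(* Two formal sums are identified when no balanced map tells them apart, which
   is the congruence generated by biadditivity and balancedness.  Lemmas
   tliftE, tlift_additive and tens_ext below are the universal property. *)
Definition tens_rel (s t : seq (M * N)) : bool :=
  `[< forall (Z : zmodType) (h : M -> N -> Z),
        balanced h -> fsum h s = fsum h t >].

Fact tens_rel_refl : reflexive tens_rel.
Proof. by move=> s; apply/asboolP. Qed.
Fact tens_rel_sym : symmetric tens_rel.
Proof.
by move=> s t; apply/asboolP/asboolP => e Z h hb; rewrite (e Z h hb).
Qed.
Fact tens_rel_trans : transitive tens_rel.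
Proof.
move=> s t u /asboolP e1 /asboolP e2; apply/asboolP => Z h hb.
by rewrite e1 // e2.
Qed.

Canonical tens_equiv :=
  EquivRel tens_rel tens_rel_refl tens_rel_sym tens_rel_trans.

Definition tens : Type := {eq_quot tens_equiv}.
HB.instance Definition _ := Choice.on tens.

Definition tcls (s : seq (M * N)) : tens := \pi_({eq_quot tens_equiv}) s.
Definition trepr (t : tens) : seq (M * N) :=
  repr (t : {eq_quot tens_equiv}).

Definition tpure (m : M) (n : N) : tens := tcls [:: (m, n)].

(* If t is the class of sum_i m_i (x) n_i, then tlift h t = sum_i h m_i n_i;
   this is meaningful (independent of the representative) for balanced h, and
   is the substitute for Sweedler notation. *)
Definition tlift (Z : zmodType) (h : M -> N -> Z) (t : tens) : Z :=
  fsum h (trepr t).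

Lemma treprK t : tcls (trepr t) = t.
Proof. exact: reprK. Qed.

Lemma tclsP s t :
  tcls s = tcls t <->
  forall (Z : zmodType) (h : M -> N -> Z),
    balanced h -> fsum h s = fsum h t.
Proof.
split; first by move/eqmodP/asboolP.
by move=> e; apply/eqmodP/asboolP.
Qed.

Lemma tlift_cls (Z : zmodType) (h : M -> N -> Z) s :
  balanced h -> tlift h (tcls s) = fsum h s.
Proof. by move=> hb; apply: (tclsP _ _).1 hb; rewrite treprK. Qed.

Lemma tliftE (Z : zmodType) (h : M -> N -> Z) m n :
  balanced h -> tlift h (tpure m n) = h m n.
Proof. by move=> hb; rewrite tlift_cls // /fsum big_seq1. Qed.

Definition tens_zero : tens := tcls [::].
Definition tens_add (s t : tens) : tens := tcls (trepr s ++ trepr t).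
Definition tens_opp (t : tens) : tens :=
  tcls [seq (- p.1, p.2) | p <- trepr t].

Lemma fsum_cat (Z : zmodType) (h : M -> N -> Z) s t :
  fsum h (s ++ t) = fsum h s + fsum h t.
Proof. by rewrite /fsum big_cat. Qed.

Lemma balanced_0l (Z : zmodType) (h : M -> N -> Z) n : balanced h -> h 0 n = 0.
Proof. by case=> hl _ _; apply: (addrI (h 0 n)); rewrite -hl !addr0. Qed.

Lemma fsum_opp (Z : zmodType) (h : M -> N -> Z) s : balanced h ->
  fsum h [seq (- p.1, p.2) | p <- s] = - fsum h s.
Proof.
move=> hb; rewrite /fsum big_map -sumrN; apply: eq_bigr => p _ /=.
have [hl _ _] := hb; apply: (addrI (h p.1 p.2)).
by rewrite -hl !subrr balanced_0l.
Qed.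

Lemma fsum_trepr (Z : zmodType) (h : M -> N -> Z) s :
  balanced h -> fsum h (trepr (tcls s)) = fsum h s.
Proof. exact: tlift_cls. Qed.

Fact tens_addA : associative tens_add.
Proof.
move=> s t u; apply/tclsP => Z h hb.
by rewrite !(fsum_cat, fsum_trepr) // addrA.
Qed.
Fact tens_addC : commutative tens_add.
Proof. by move=> s t; apply/tclsP => Z h hb; rewrite !fsum_cat addrC. Qed.
Fact tens_add0 : left_id tens_zero tens_add.
Proof.
move=> t; rewrite -[RHS]treprK; apply/tclsP => Z h hb.
by rewrite fsum_cat fsum_trepr // /fsum big_nil add0r.
Qed.
Fact tens_addN : left_inverse tens_zero tens_opp tens_add.
Proof.
move=> t; apply/tclsP => Z h hb.
by rewrite fsum_cat fsum_trepr // fsum_opp // addNr /fsum big_nil.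
Qed.

HB.instance Definition _ :=
  GRing.isZmodule.Build tens tens_addA tens_addC tens_add0 tens_addN.

Lemma tlift_additive (Z : zmodType) (h : M -> N -> Z) :
  balanced h -> {morph tlift h : s t / s + t}.
Proof. by move=> hb s t; rewrite [LHS]tlift_cls // fsum_cat. Qed.

Lemma tcls_cons p s : tcls (p :: s) = tpure p.1 p.2 + tcls s.
Proof.
apply/tclsP => Z h hb.
by rewrite fsum_cat !fsum_trepr // -fsum_cat /=; case: p.
Qed.

Lemma tpure_balanced : balanced tpure.
Proof.
split=> [m m' n|m n n'|m a n].
- rewrite -[tpure m' n]addr0 -[0]/(tcls [::]) -(tcls_cons (m', n)).
  rewrite -(tcls_cons (m, n)); apply/tclsP => Z h [hl hr hs].
  by rewrite /fsum !big_cons !big_nil /= hl !addr0.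
- rewrite -[tpure m n']addr0 -[0]/(tcls [::]) -(tcls_cons (m, n')).
  rewrite -(tcls_cons (m, n)); apply/tclsP => Z h [hl hr hs].
  by rewrite /fsum !big_cons !big_nil /= hr !addr0.
- by apply/tclsP => Z h [hl hr hs]; rewrite /fsum !big_cons !big_nil /= hs.
Qed.

Lemma tcls_sum s : tcls s = fsum tpure s.
Proof.
elim: s => [|p s IHs]; first by rewrite /fsum big_nil.
by rewrite tcls_cons IHs /fsum big_cons.
Qed.

Lemma tlift_pure t : tlift tpure t = t.
Proof. by rewrite /tlift -tcls_sum treprK. Qed.

Lemma additive0 (U V : zmodType) (F : U -> V) :
  {morph F : x y / x + y} -> F 0 = 0.
Proof. by move=> FD; apply: (addrI (F 0)); rewrite -FD !addr0. Qed.

(* No balancedness is needed here: only one representative is involved. *)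
Lemma tlift_comp (Y Z : zmodType) (F : Y -> Z) (h : M -> N -> Y) t :
  {morph F : x y / x + y} -> F (tlift h t) = tlift (fun m n => F (h m n)) t.
Proof.
by move=> FD; apply: (big_morph F FD); apply: additive0.
Qed.

Lemma eq_tlift (Z : zmodType) (h k : M -> N -> Z) t :
  (forall m n, h m n = k m n) -> tlift h t = tlift k t.
Proof. by move=> e; apply: eq_bigr => p _; apply: e. Qed.

Lemma tliftD (Z : zmodType) (h k : M -> N -> Z) t :
  tlift (fun m n => h m n + k m n) t = tlift h t + tlift k t.
Proof. exact: big_split. Qed.

Lemma tens_ext (Z : zmodType) (F G : tens -> Z) :
  {morph F : s t / s + t} -> {morph G : s t / s + t} ->
  (forall m n, F (tpure m n) = G (tpure m n)) -> forall t, F t = G t.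
Proof.
move=> FD GD e t; rewrite -[t]tlift_pure !tlift_comp //.
by apply: eq_tlift => m n.
Qed.
End Tensor.
Arguments tpure {A} M N m n.
Arguments tens {A} M N.

Section TensorLmodule.
Variables (B A : pzRingType) (M : bimodType B A) (N : lmodType A).

Definition tens_lact (b : B) (t : tens M N) : tens M N :=
  tlift (fun m n => tpure M N (b *: m) n) t.

Lemma tens_lact_balanced b : balanced (fun m n => tpure M N (b *: m) n).
Proof.
have [hl hr hs] := tpure_balanced M N.
split=> [m m' n|m n n'|m a n]; rewrite ?scalerDr ?hl ?hr //.
by rewrite -bimodA hs.
Qed.

Lemma tens_lactE b m n :
  tens_lact b (tpure M N m n) = tpure M N (b *: m) n.
Proof. by rewrite /tens_lact tliftE //; apply: tens_lact_balanced. Qed.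

Fact tens_lactDr : right_distributive tens_lact +%R.
Proof. by move=> b; apply/tlift_additive/tens_lact_balanced. Qed.
Fact tens_lactA a b t : tens_lact a (tens_lact b t) = tens_lact (a * b) t.
Proof.
move: t; apply: tens_ext => [s t|s t|m n]; rewrite ?tens_lactDr //.
by rewrite !tens_lactE scalerA.
Qed.
Fact tens_lact1 : left_id 1 tens_lact.
Proof.
move=> t; move: t; apply: tens_ext => [s t|//|m n]; rewrite ?tens_lactDr //.
by rewrite !tens_lactE scale1r.
Qed.
Fact tens_lactDl t : {morph tens_lact^~ t : a b / a + b}.
Proof.
have [hl _ _] := tpure_balanced M N.
move=> a b; rewrite /tens_lact -tliftD.
by apply: eq_tlift => m n; rewrite scalerDl hl.
Qed.

HB.instance Definition _ := GRing.Zmodule_isLmodule.Build B (tens M N)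
  tens_lactA tens_lact1 tens_lactDr tens_lactDl.

Lemma scale_tpure (b : B) m n : b *: tpure M N m n = tpure M N (b *: m) n.
Proof. exact: tens_lactE. Qed.
End TensorLmodule.

Section TensorRmodule.
Variables (A B : pzRingType) (M : rmodType A) (N : bimodType A B).

Definition tens_ract (t : tens M N) (b : B) : tens M N :=
  tlift (fun m n => tpure M N m (n :* b)) t.

Lemma tens_ract_balanced b : balanced (fun m n => tpure M N m (n :* b)).
Proof.
have [hl hr hs] := tpure_balanced M N.
split=> [m m' n|m n n'|m a n]; rewrite ?ractDl ?hl ?hr //.
by rewrite bimodA hs.
Qed.

Lemma tens_ractE b m n :
  tens_ract (tpure M N m n) b = tpure M N m (n :* b).
Proof. by rewrite /tens_ract tliftE //; apply: tens_ract_balanced. Qed.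

Fact tens_ractDl b : {morph tens_ract^~ b : s t / s + t}.
Proof. exact/tlift_additive/tens_ract_balanced. Qed.
Fact tens_ractA t a b : tens_ract (tens_ract t a) b = tens_ract t (a * b).
Proof.
move: t; apply: tens_ext => [s t|s t|m n]; rewrite ?tens_ractDl //.
by rewrite !tens_ractE ractA.
Qed.
Fact tens_ract1 t : tens_ract t 1 = t.
Proof.
move: t; apply: tens_ext => [s t|//|m n]; rewrite ?tens_ractDl //.
by rewrite !tens_ractE ract1.
Qed.
Fact tens_ractDr t : {morph tens_ract t : a b / a + b}.
Proof.
have [_ hr _] := tpure_balanced M N.
move=> a b; rewrite /tens_ract -tliftD.
by apply: eq_tlift => m n; rewrite ractDr hr.
Qed.

HB.instance Definition _ := Zmodule_isRmodule.Build B (tens M N)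
  tens_ractA tens_ract1 tens_ractDl tens_ractDr.

Lemma ract_tpure (b : B) m n : tpure M N m n :* b = tpure M N m (n :* b).
Proof. exact: tens_ractE. Qed.
End TensorRmodule.

Section TensorBimodule.
Variables (B A D : pzRingType) (M : bimodType B A) (N : bimodType A D).

Fact tens_bimodA (b : B) (t : tens M N) (d : D) :
  (b *: t) :* d = b *: (t :* d).
Proof.
move: t; apply: tens_ext => [s t|s t|m n].
- by rewrite scalerDr ractDl.
- by rewrite ractDl scalerDr.
- by rewrite scale_tpure !ract_tpure scale_tpure.
Qed.

HB.instance Definition _ := isBimodule.Build B D (tens M N) tens_bimodA.
End TensorBimodule.

Section LinearMaps.
Variable A : pzRingType.

Lemma rlinear_additive (M N : rmodType A) (f : M -> N) :
  rlinear f -> {morph f : x y / x + y}.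
Proof. by move=> fl x y; have := fl 1 x y; rewrite !ract1. Qed.
Lemma rlinear_ract (M N : rmodType A) (f : M -> N) :
  rlinear f -> forall x a, f (x :* a) = f x :* a.
Proof.
move=> fl x a; have := fl a x 0.
by rewrite (additive0 (rlinear_additive fl)) !addr0.
Qed.
Lemma linear_additive (M N : lmodType A) (f : M -> N) :
  linear f -> {morph f : x y / x + y}.
Proof. by move=> fl x y; have := fl 1 x y; rewrite !scale1r. Qed.
Lemma linear_scale (M N : lmodType A) (f : M -> N) :
  linear f -> forall a x, f (a *: x) = a *: f x.
Proof.
move=> fl a x; have := fl a x 0.
by rewrite (additive0 (linear_additive fl)) !addr0.
Qed.

Lemma tmap_balanced (M M' : rmodType A) (N N' : lmodType A)
    (f : M -> M') (g : N -> N') : rlinear f -> linear g ->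
  balanced (fun m n => tpure M' N' (f m) (g n)).
Proof.
move=> fl gl; have [hl hr hs] := tpure_balanced M' N'.
have fD := rlinear_additive fl; have gD := linear_additive gl.
split=> [m m' n|m n n'|m a n]; rewrite ?fD ?gD ?hl ?hr //.
by rewrite (rlinear_ract fl) (linear_scale gl) hs.
Qed.
End LinearMaps.

(* Maps between tensor products.  Like tlift, they are total; they are the
   usual maps when f, g are module maps on the sides that are tensored. *)

Definition tmap (A : pzRingType) (M M' : rmodType A) (N N' : lmodType A)
    (f : M -> M') (g : N -> N') : tens M N -> tens M' N' :=
  tlift (fun m n => tpure M' N' (f m) (g n)).

Definition tassoc (A B : pzRingType) (M : rmodType A) (N : bimodType A B)
    (P : lmodType B) : tens (tens M N) P -> tens M (tens N P) :=
  tlift (fun t p => tlift (fun m n => tpure M (tens N P) m (tpure N P n p)) t).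

Lemma tmapE (A : pzRingType) (M M' : rmodType A) (N N' : lmodType A)
    (f : M -> M') (g : N -> N') m n : rlinear f -> linear g ->
  tmap f g (tpure M N m n) = tpure M' N' (f m) (g n).
Proof. by move=> fl gl; rewrite /tmap tliftE //; apply: tmap_balanced. Qed.

Section TensorAssociativity.
Variables (A B : pzRingType) (M : rmodType A) (N : bimodType A B).
Variable (P : lmodType B).

Lemma tassoc_balanced1 (p : P) :
  balanced (fun m n => tpure M (tens N P) m (tpure N P n p)).
Proof.
have [pl pr ps] := tpure_balanced N P.
have [ql qr qs] := tpure_balanced M (tens N P).
split=> [m m' n|m n n'|m a n]; rewrite ?ql ?pl ?qr //.
by rewrite qs scale_tpure.
Qed.

Lemma tassoc_balanced :
  balanced (fun (t : tens M N) (p : P) =>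
    tlift (fun m n => tpure M (tens N P) m (tpure N P n p)) t).
Proof.
have [pl pr ps] := tpure_balanced N P.
have [ql qr qs] := tpure_balanced M (tens N P).
have ab := tassoc_balanced1.
split=> [s t z|t z z'|t a z].
- by rewrite tlift_additive.
- by rewrite -tliftD; apply: eq_tlift => x y; rewrite pr qr.
- move: t; apply: tens_ext => [s t|s t|x y].
  + by rewrite ractDl tlift_additive.
  + by rewrite tlift_additive.
  + by rewrite ract_tpure !tliftE // ps.
Qed.

Lemma tassocE m n p :
  tassoc (tpure (tens M N) P (tpure M N m n) p) =
  tpure M (tens N P) m (tpure N P n p).
Proof.
rewrite /tassoc tliftE; last exact: tassoc_balanced.
by rewrite tliftE //; apply: tassoc_balanced1.
Qed.
End TensorAssociativity.

Definition coassociative (A : pzRingType) (C : bimodType A A)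
    (Delta : C -> tens C C) : Prop :=
  forall c, tassoc (tmap Delta id (Delta c)) = tmap id Delta (Delta c).

Definition is_coring (A : pzRingType) (C : bimodType A A)
    (Delta : C -> tens C C) : Prop :=
  bimod_linear Delta /\ coassociative Delta.

Definition is_counit (A : pzRingType) (C : bimodType A A)
    (Delta : C -> tens C C) (eps : C -> A^o) : Prop :=
  bimod_linear eps /\
  forall c, tlift (fun x y => (eps x : A) *: y) (Delta c) = c /\
            tlift (fun x y => x :* (eps y : A)) (Delta c) = c.

Definition is_counital_coring (A : pzRingType) (C : bimodType A A)
    (Delta : C -> tens C C) (eps : C -> A^o) : Prop :=
  is_coring Delta /\ is_counit Delta eps.

Record coalgebra (R : comNzRingType) := Coalgebra {
  coalg_car :> bimodType R R;
  comul : coalg_car -> tens coalg_car coalg_car;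
  counit : coalg_car -> R^o;
  coalg_coring : is_counital_coring comul counit;
  coalg_sym : forall (r : R) (c : coalg_car), r *: c = c :* r
}.
Arguments comul {R} C c : rename.
Arguments counit {R} C c : rename.

(* Unital R-algebras, as rings with a central structure map from R. *)

Record algebra (R : comNzRingType) := Algebra {
  alg_ring :> pzRingType;
  alg_unit : {rmorphism R -> alg_ring};
  alg_central : forall r a, alg_unit r * a = a * alg_unit r
}.
Arguments alg_unit {R} A : rename.

Definition base_algebra (R : comNzRingType) : algebra R :=
  @Algebra R R idfun (@mulrC R).

Record alg_morphism (R : comNzRingType) (A B : algebra R) := AlgMorphism {
  alg_mor :> {rmorphism A -> B};
  alg_morE : forall r, alg_mor (alg_unit A r) = alg_unit B r
}.

Definition restr (A B : pzRingType) (g : {rmorphism A -> B})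
  (M : bimodType B B) : Type := M.

Section Restriction.
Variables (A B : pzRingType) (g : {rmorphism A -> B}) (M : bimodType B B).
Local Notation restr := (restr g M).
HB.instance Definition _ := GRing.Zmodule.on restr.

Definition restr_scale (a : A) (x : restr) : restr := g a *: (x : M).
Definition restr_ract (x : restr) (a : A) : restr := (x : M) :* g a.

Fact restr_scaleA a b x :
  restr_scale a (restr_scale b x) = restr_scale (a * b) x.
Proof. by rewrite /restr_scale scalerA rmorphM. Qed.
Fact restr_scale1 : left_id 1 restr_scale.
Proof. by move=> x; rewrite /restr_scale rmorph1 scale1r. Qed.
Fact restr_scaleDr : right_distributive restr_scale +%R.
Proof. by move=> a x y; apply: scalerDr. Qed.
Fact restr_scaleDl x : {morph restr_scale^~ x : a b / a + b}.
Proof. by move=> a b; rewrite /restr_scale rmorphD; apply: scalerDl. Qed.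
HB.instance Definition _ := GRing.Zmodule_isLmodule.Build A restr
  restr_scaleA restr_scale1 restr_scaleDr restr_scaleDl.

Fact restr_ractA x a b : restr_ract (restr_ract x a) b = restr_ract x (a * b).
Proof. by rewrite /restr_ract ractA rmorphM. Qed.
Fact restr_ract1 x : restr_ract x 1 = x.
Proof. by rewrite /restr_ract rmorph1 ract1. Qed.
Fact restr_ractDl a : {morph restr_ract^~ a : x y / x + y}.
Proof. by move=> x y; apply: ractDl. Qed.
Fact restr_ractDr x : {morph restr_ract x : a b / a + b}.
Proof. by move=> a b; rewrite /restr_ract rmorphD; apply: ractDr. Qed.
HB.instance Definition _ := Zmodule_isRmodule.Build A restr
  restr_ractA restr_ract1 restr_ractDl restr_ractDr.

Fact restr_bimodA (a : A) (x : restr) (b : A) : (a *: x) :* b = a *: (x :* b).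
Proof. exact: (@bimodA B B M (g a) x (g b)). Qed.
HB.instance Definition _ := isBimodule.Build A A restr restr_bimodA.

Definition restr_chi : tens restr restr -> tens M M :=
  tlift (fun x y : restr => tpure M M x y).

Lemma restr_chiE (x y : restr) :
  restr_chi (tpure restr restr x y) = tpure M M x y.
Proof.
rewrite /restr_chi tliftE //; have [hl hr hs] := tpure_balanced M M.
by split=> [m m' n|m n n'|m a n]; [apply: hl | apply: hr | apply: hs].
Qed.
End Restriction.

Definition is_coring_morphism (R : comNzRingType) (A B : algebra R)
    (C : bimodType A A) (DeltaC : C -> tens C C)
    (D : bimodType B B) (DeltaD : D -> tens D D)
    (g : alg_morphism A B) (theta : C -> D) : Prop :=
  bimod_linear (theta : C -> restr g D) /\
  forall c, restr_chi (tmap (theta : C -> restr g D) (theta : C -> restr g D)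
                            (DeltaC c))
            = DeltaD (theta c).

Section CoalgebraTheory.
Variables (R : comNzRingType) (C : coalgebra R).
Local Notation Delta := (comul C).
Local Notation eps := (counit C).

Lemma comulP : bimod_linear Delta.
Proof. by case: C => ? ? ? [[]]. Qed.
Lemma comul_coassoc : coassociative Delta.
Proof. by case: C => ? ? ? [[]]. Qed.
Lemma counitP : is_counit Delta eps.
Proof. by case: C => ? ? ? []. Qed.

Lemma comulD : {morph Delta : x y / x + y}.
Proof. by move=> x y; have := comulP.1 1 x y; rewrite !scale1r. Qed.
Lemma comulZ r c : Delta (r *: c) = r *: Delta c.
Proof.
by have := comulP.1 r c 0; rewrite addr0 (additive0 comulD) addr0.
Qed.
Lemma comulZr r c : Delta (c :* r) = Delta c :* r.
Proof.
by have := comulP.2 r c 0; rewrite addr0 (additive0 comulD) addr0.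
Qed.

Lemma sweedler3 (Z : zmodType) (h : C -> C -> C -> Z) c :
  (forall z, balanced (fun x y => h x y z)) ->
  (forall x, balanced (fun y z => h x y z)) ->
  tlift (fun a z => tlift (fun x y => h x y z) (Delta a)) (Delta c) =
  tlift (fun x b => tlift (fun y z => h x y z) (Delta b)) (Delta c).
Proof.
move=> hz hx.
pose phi := tlift (fun (x : C) (t : tens C C) => tlift (h x) t).
have hb : balanced (fun (x : C) (t : tens C C) => tlift (h x) t).
  split=> [m m' t|m s t|m a t]; last 1 first.
  - move: t; apply: tens_ext => [s t|s t|y z].
    + by rewrite tlift_additive.
    + by rewrite scalerDr tlift_additive.
    + by rewrite scale_tpure !tliftE //; have [_ _ ->] := hz z.
  - rewrite -tliftD; apply: eq_tlift => y z.
    by have [-> _ _] := hz z.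
  - by rewrite tlift_additive.
have phiD : {morph phi : s t / s + t} by exact: tlift_additive.
have phiE x t : phi (tpure C (tens C C) x t) = tlift (h x) t by exact: tliftE.
have ab := @tassoc_balanced1 R R C C C.
have ab2 := @tassoc_balanced R R C C C.
have assD : {morph @tassoc R R C C C : s t / s + t} by exact: tlift_additive.
have := congr1 phi (comul_coassoc c); rewrite /tmap !tlift_comp // => e.
transitivity (tlift (fun m n => phi (tpure C (tens C C) m (Delta n))) (Delta c)).
  rewrite -e; apply: eq_tlift => a z; rewrite /tassoc tliftE // tlift_comp //.
  by apply: eq_tlift => x y; rewrite phiE tliftE.
by apply: eq_tlift => x b; rewrite phiE.
Qed.

End CoalgebraTheory.

Definition bullet (R : comNzRingType) (C : coalgebra R) : Type :=
  {linear C -> R^o}.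

Section Bullet.
Variables (R : comNzRingType) (C : coalgebra R).
Local Notation Delta := (comul C).
Local Notation eps := (counit C).
Implicit Types f g h : bullet C.


Lemma bullet_ext f g : f =1 g -> f = g.
Proof.
case: f g => [f [[fm] [fs]]] [g [[gm] [gs]]] /= /funext e.
rewrite /= in e; subst g; congr GRing.Linear.Pack.
congr GRing.Linear.Class.
  by congr Algebra.isNmodMorphism.Axioms_; apply: Prop_irrelevance.
by congr GRing.isScalable.Axioms_; apply: Prop_irrelevance.
Qed.

Definition bullet_of (u : C -> R) (u_lin : linear (u : C -> R^o)) : bullet C :=
  HB.pack_for {linear C -> R^o} u
    (GRing.isLinear.Build R C R^o *:%R u u_lin).

Lemma bulletD f x y : f (x + y) = f x + f y :> R.
Proof. exact: raddfD. Qed.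
Lemma bulletZ f r x : f (r *: x) = r * f x :> R.
Proof. exact: (linearZ_LR (f : {linear C -> R^o})). Qed.
Lemma bulletZr f x r : f (x :* r) = f x * r :> R.
Proof. by rewrite -coalg_sym bulletZ mulrC. Qed.

HB.instance Definition _ := gen_eqMixin (bullet C).
HB.instance Definition _ := gen_choiceMixin (bullet C).

Fact bullet_zero_lin : linear ((fun=> 0) : C -> R^o).
Proof. by move=> r x y; rewrite scaler0 addr0. Qed.
Fact bullet_add_lin f g : linear ((fun c => f c + g c) : C -> R^o).
Proof.
by move=> r x y; rewrite !bulletD !bulletZ /GRing.scale /= mulrDr addrACA.
Qed.
Fact bullet_opp_lin f : linear ((fun c => - f c) : C -> R^o).
Proof.
by move=> r x y; rewrite bulletD bulletZ /GRing.scale /= mulrN opprD.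
Qed.

Definition bullet_zero : bullet C := bullet_of bullet_zero_lin.
Definition bullet_add f g : bullet C := bullet_of (bullet_add_lin f g).
Definition bullet_opp f : bullet C := bullet_of (bullet_opp_lin f).

Fact bullet_addA : associative bullet_add.
Proof. by move=> f g h; apply: bullet_ext => c; apply: addrA. Qed.
Fact bullet_addC : commutative bullet_add.
Proof. by move=> f g; apply: bullet_ext => c; apply: addrC. Qed.
Fact bullet_add0 : left_id bullet_zero bullet_add.
Proof. by move=> f; apply: bullet_ext => c; apply: add0r. Qed.
Fact bullet_addN : left_inverse bullet_zero bullet_opp bullet_add.
Proof. by move=> f; apply: bullet_ext => c; apply: addNr. Qed.
HB.instance Definition _ := GRing.isZmodule.Build (bullet C)
  bullet_addA bullet_addC bullet_add0 bullet_addN.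

Lemma bullet_addE f g c : (f + g) c = f c + g c :> R.
Proof. by []. Qed.

Lemma conv_balanced f g : balanced (fun x y : C => g x * f y : R).
Proof.
split=> [m m' n|m n n'|m a n]; rewrite ?bulletD ?mulrDl ?mulrDr //.
by rewrite bulletZr bulletZ mulrA.
Qed.

(* The product of C^bullet is the opposite of convolution. *)
Definition conv f g (c : C) : R := tlift (fun x y : C => g x * f y : R) (Delta c).

Lemma comul_lin : linear Delta.
Proof. exact: (comulP C).1. Qed.

Lemma tlift_scale (h : C -> C -> R) r (t : tens C C) : balanced h ->
  (forall x y, h (r *: x) y = r * h x y) -> tlift h (r *: t) = r * tlift h t.
Proof.
move=> hb hr; move: t; apply: tens_ext => [s t|s t|x y].
- by rewrite scalerDr tlift_additive.
- by rewrite tlift_additive // mulrDr.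
- by rewrite scale_tpure !tliftE.
Qed.

Fact conv_lin f g : linear (conv f g : C -> R^o).
Proof.
have hb := conv_balanced f g.
move=> r x y; rewrite /conv comulD comulZ tlift_additive //.
by rewrite tlift_scale // => u v; rewrite bulletZ mulrA.
Qed.

Definition bullet_mul f g : bullet C := bullet_of (conv_lin f g).

Fact counit_lin : linear (eps : C -> R^o).
Proof. exact: (counitP C).1.1. Qed.
Definition bullet_one : bullet C := bullet_of counit_lin.

Fact bullet_mulA : associative bullet_mul.
Proof.
move=> f g h; apply: bullet_ext => c; rewrite /= /conv /=.
transitivity (tlift (fun a z : C =>
    tlift (fun x y : C => h x * g y * f z : R) (Delta a)) (Delta c)).
  apply: eq_tlift => a z; rewrite /conv.
  by rewrite (@tlift_comp _ _ _ _ _ (fun u : R => u * f z)) // => u v; apply: mulrDl.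
transitivity (tlift (fun x b : C =>
    tlift (fun y z : C => h x * g y * f z : R) (Delta b)) (Delta c)).
  apply: sweedler3 => [z|x]; split=> [m m' n|m n n'|m a n];
    rewrite ?bulletD ?mulrDl ?mulrDr ?mulrDl //.
  - by rewrite bulletZr bulletZ !mulrA.
  - by rewrite bulletZr bulletZ !mulrA.
apply: eq_tlift => x b; rewrite /conv.
rewrite (@tlift_comp _ _ _ _ _ (fun u : R => h x * u)); last first.
  by move=> u v; apply: mulrDr.
by apply: eq_tlift => y z; rewrite mulrA.
Qed.

Fact bullet_mul1 : right_id bullet_one bullet_mul.
Proof.
move=> f; apply: bullet_ext => c; rewrite /= /conv /=.
have [_ /(_ c)[e _]] := counitP C.
rewrite -[RHS](congr1 f e) (@tlift_comp _ _ _ _ _ (f : C -> R)).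
  by apply: eq_tlift => x y; rewrite bulletZ.
by move=> x y; apply: bulletD.
Qed.

Fact bullet_1mul : left_id bullet_one bullet_mul.
Proof.
move=> f; apply: bullet_ext => c; rewrite /= /conv /=.
have [_ /(_ c)[_ e]] := counitP C.
rewrite -[RHS](congr1 f e) (@tlift_comp _ _ _ _ _ (f : C -> R)).
  by apply: eq_tlift => x y; rewrite bulletZr.
by move=> x y; apply: bulletD.
Qed.

Fact bullet_mulDl : left_distributive bullet_mul +%R.
Proof.
move=> f g h; apply: bullet_ext => c; rewrite bullet_addE /= /conv -tliftD.
by apply: eq_tlift => x y; rewrite bullet_addE mulrDr.
Qed.
Fact bullet_mulDr : right_distributive bullet_mul +%R.
Proof.
move=> f g h; apply: bullet_ext => c; rewrite bullet_addE /= /conv -tliftD.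
by apply: eq_tlift => x y; rewrite bullet_addE mulrDl.
Qed.

HB.instance Definition _ := GRing.Zmodule_isPzRing.Build (bullet C)
  bullet_mulA bullet_1mul bullet_mul1 bullet_mulDl bullet_mulDr.

Lemma bullet_mulE f g c :
  (f * g) c = tlift (fun x y : C => g x * f y : R) (Delta c).
Proof. by []. Qed.
Lemma bullet_oneE c : (1 : bullet C) c = eps c.
Proof. by []. Qed.

Fact eta_lin (r : R) : linear ((fun c => r * (eps c : R)) : C -> R^o).
Proof.
move=> s x y; rewrite counit_lin /GRing.scale /= mulrDr.
by congr (_ + _); rewrite mulrCA.
Qed.
Definition eta (r : R) : bullet C := bullet_of (eta_lin r).

Fact eta_zmod : zmod_morphism eta.
Proof. by move=> r s; apply: bullet_ext => c; rewrite /= mulrBl. Qed.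
Lemma eta_mull r f c : (eta r * f) c = r * f c :> R.
Proof.
rewrite -[in RHS](mul1r f) !bullet_mulE.
rewrite (@tlift_comp _ _ _ _ _ (fun u : R => r * u)); last first.
  by move=> u v; apply: mulrDr.
by apply: eq_tlift => x y; rewrite mulrCA.
Qed.
Lemma eta_mulr r f c : (f * eta r) c = r * f c :> R.
Proof.
rewrite -[in RHS](mulr1 f) !bullet_mulE.
rewrite (@tlift_comp _ _ _ _ _ (fun u : R => r * u)); last first.
  by move=> u v; apply: mulrDr.
by apply: eq_tlift => x y; rewrite mulrA.
Qed.
Fact eta_monoid : monoid_morphism eta.
Proof.
split=> [|r s]; apply: bullet_ext => c; first by rewrite /= mul1r.
by rewrite eta_mull /= mulrA.
Qed.
HB.instance Definition _ := GRing.isZmodMorphism.Build R (bullet C) eta eta_zmod.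
HB.instance Definition _ := GRing.isMonoidMorphism.Build R (bullet C) eta eta_monoid.

Fact eta_central r f : eta r * f = f * eta r.
Proof. by apply: bullet_ext => c; rewrite eta_mull eta_mulr. Qed.

Definition bullet_algebra : algebra R :=
  @Algebra R (bullet C) eta eta_central.
End Bullet.

(* The canonical (C^bullet, C^bullet)-bimodule on C:
   f -> c = sum f(c1) c2 and c <- g = sum c1 g(c2). *)

Definition bold_car (R : comNzRingType) (C : coalgebra R) : Type := C.

Section Bold.
Variables (R : comNzRingType) (C : coalgebra R).
Local Notation Delta := (comul C).
Local Notation eps := (counit C).
Implicit Types (f g : bullet C) (c d : C).

Definition lharp f c : C := tlift (fun x y : C => (f x : R) *: y) (Delta c).
Definition rharp c g : C := tlift (fun x y : C => x :* (g y : R)) (Delta c).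

Lemma lharp_balanced f : balanced (fun x y : C => (f x : R) *: y).
Proof.
split=> [m m' n|m n n'|m a n]; rewrite ?bulletD ?scalerDl ?scalerDr //.
by rewrite bulletZr scalerA.
Qed.
Lemma rharp_balanced g : balanced (fun x y : C => x :* (g y : R)).
Proof.
split=> [m m' n|m n n'|m a n]; rewrite ?bulletD ?ractDl ?ractDr //.
by rewrite ractA bulletZ.
Qed.

Fact lharpDr : right_distributive lharp +%R.
Proof.
by move=> f c d; rewrite /lharp comulD tlift_additive //; apply: lharp_balanced.
Qed.
Fact rharpDl g : {morph rharp^~ g : c d / c + d}.
Proof.
by move=> c d; rewrite /rharp comulD tlift_additive //; apply: rharp_balanced.
Qed.
Fact lharpDl c : {morph lharp^~ c : f g / f + g}.
Proof.
move=> f g; rewrite /lharp -tliftD.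
by apply: eq_tlift => x y; rewrite bullet_addE scalerDl.
Qed.
Fact rharpDr c : {morph rharp c : f g / f + g}.
Proof.
move=> f g; rewrite /rharp -tliftD.
by apply: eq_tlift => x y; rewrite bullet_addE ractDr.
Qed.
Fact lharp1 : left_id (1 : bullet C) lharp.
Proof. by move=> c; have [_ /(_ c)[]] := counitP C. Qed.
Fact rharp1 c : rharp c 1 = c.
Proof. by have [_ /(_ c)[]] := counitP C. Qed.

Lemma lharpZ f r c : lharp f (r *: c) = r *: lharp f c.
Proof.
rewrite /lharp comulZ; move: (Delta c); apply: tens_ext => [s t|s t|x y].
- by rewrite scalerDr tlift_additive //; apply: lharp_balanced.
- by rewrite tlift_additive ?scalerDr //; apply: lharp_balanced.
- by rewrite scale_tpure !tliftE ?bulletZ ?scalerA //; apply: lharp_balanced.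
Qed.
Lemma rharpZ g r c : rharp (c :* r) g = rharp c g :* r.
Proof.
rewrite /rharp comulZr; move: (Delta c); apply: tens_ext => [s t|s t|x y].
- by rewrite ractDl tlift_additive //; apply: rharp_balanced.
- by rewrite tlift_additive ?ractDl //; apply: rharp_balanced.
- by rewrite ract_tpure !tliftE ?bulletZr ?ractA //; apply: rharp_balanced.
Qed.
Lemma rharpZl g r c : rharp (r *: c) g = r *: rharp c g.
Proof. by rewrite coalg_sym rharpZ -coalg_sym. Qed.

Fact lharpA f g c : lharp f (lharp g c) = lharp (f * g) c.
Proof.
rewrite {2}/lharp tlift_comp; last by move=> x y; apply: lharpDr.
transitivity (tlift (fun x b : C =>
    tlift (fun y z : C => (g x * f y : R) *: z) (Delta b)) (Delta c)).
  apply: eq_tlift => x b; rewrite lharpZ tlift_comp; last exact: scalerDr.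
  by apply: eq_tlift => y z; rewrite scalerA.
rewrite -sweedler3; last 1 first.
- move=> x; split=> [m m' n|m n n'|m a n].
  + by rewrite bulletD mulrDr scalerDl.
  + by rewrite scalerDr.
  + by rewrite bulletZr mulrA scalerA.
- apply: eq_tlift => a z; rewrite bullet_mulE.
  by rewrite (@tlift_comp _ _ _ _ _ (fun u : R => u *: z)) // => u v; apply: scalerDl.
- move=> z; split=> [m m' n|m n n'|m a n].
  + by rewrite bulletD mulrDl scalerDl.
  + by rewrite bulletD mulrDr scalerDl.
  + by rewrite bulletZr bulletZ mulrA.
Qed.

Fact rharpA c f g : rharp (rharp c f) g = rharp c (f * g).
Proof.
rewrite [rharp c f]/rharp (@tlift_comp _ _ _ _ _ (rharp^~ g)); last exact: rharpDl.
transitivity (tlift (fun a z : C =>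
    tlift (fun x y : C => x :* (g y * f z : R)) (Delta a)) (Delta c)).
  apply: eq_tlift => a z; rewrite rharpZ /rharp (@tlift_comp _ _ _ _ _ (fun u : C => u :* (f z : R))); last exact: ractDl.
  by apply: eq_tlift => x y; rewrite ractA.
rewrite sweedler3.
- apply: eq_tlift => x b; rewrite bullet_mulE.
  by rewrite (@tlift_comp _ _ _ _ _ (fun u : R => x :* u)) // => u v; apply: ractDr.
- move=> z; split=> [m m' n|m n n'|m a n].
  + by rewrite ractDl.
  + by rewrite bulletD mulrDl ractDr.
  + by rewrite bulletZ ractA mulrA.
- move=> x; split=> [m m' n|m n n'|m a n].
  + by rewrite bulletD mulrDl ractDr.
  + by rewrite bulletD mulrDr ractDr.
  + by rewrite bulletZr bulletZ mulrA.
Qed.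

Fact harpA f c g : rharp (lharp f c) g = lharp f (rharp c g).
Proof.
rewrite [lharp f c]/lharp (@tlift_comp _ _ _ _ _ (rharp^~ g)); last exact: rharpDl.
rewrite [rharp c g]/rharp (@tlift_comp _ _ _ _ _ (lharp f)); last exact: lharpDr.
transitivity (tlift (fun x b : C =>
    tlift (fun y z : C => ((f x : R) *: y) :* (g z : R)) (Delta b)) (Delta c)).
  apply: eq_tlift => x b; rewrite rharpZl /rharp tlift_comp; last exact: scalerDr.
  by apply: eq_tlift => y z; rewrite bimodA.
rewrite -sweedler3.
- apply: eq_tlift => a z.
  rewrite -coalg_sym lharpZ coalg_sym /lharp.
  by rewrite (@tlift_comp _ _ _ _ _ (fun u : C => u :* (g z : R))) //; apply: ractDl.
- move=> z; split=> [m m' n|m n n'|m a n].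
  + by rewrite bulletD scalerDl ractDl.
  + by rewrite scalerDr ractDl.
  + by rewrite bulletZr -scalerA.
- move=> x; split=> [m m' n|m n n'|m a n].
  + by rewrite scalerDr ractDl.
  + by rewrite bulletD ractDr.
  + by rewrite bulletZ -bimodA ractA.
Qed.

HB.instance Definition _ := GRing.Zmodule.on (bold_car C).
HB.instance Definition _ := GRing.Zmodule_isLmodule.Build (bullet C) (bold_car C)
  lharpA lharp1 lharpDr lharpDl.
HB.instance Definition _ := Zmodule_isRmodule.Build (bullet C) (bold_car C)
  rharpA rharp1 rharpDl rharpDr.
HB.instance Definition _ := isBimodule.Build (bullet C) (bullet C) (bold_car C)
  harpA.

Definition bold : bimodType (bullet C) (bullet C) := bold_car C.

Definition bold_comul (c : bold) : tens bold bold :=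
  tlift (fun x y : C => tpure bold bold x y) (Delta c).

Lemma eta_lharp (r : R) (x : bold) : eta C r *: x = (r *: (x : C) : C).
Proof.
rewrite -[in RHS](lharp1 x) -[LHS]/(lharp _ _) /lharp tlift_comp.
  by apply: eq_tlift => y z; rewrite scalerA.
exact: scalerDr.
Qed.
Lemma eta_rharp (r : R) (x : bold) : x :* eta C r = ((x : C) :* r : C).
Proof.
rewrite -[in RHS](rharp1 x) -[LHS]/(rharp _ _) /rharp.
rewrite (@tlift_comp _ _ _ _ _ (fun u : C => u :* r)); last exact: ractDl.
by apply: eq_tlift => y z; rewrite ractA mulrC.
Qed.

(* The canonical map C (x)_R C -> C (x)_{C^bullet} C is well defined. *)
Lemma bold_tpure_balanced : balanced (fun x y : C => tpure bold bold x y).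
Proof.
have [hl hr hs] := tpure_balanced bold bold.
split=> [m m' n|m n n'|m r n]; [exact: hl | exact: hr |].
by rewrite -eta_rharp -eta_lharp; apply: hs.
Qed.

Definition hat : bimodType (bullet C) (bullet C) :=
  (bold * (bullet C)^o)%type.

Definition hat_comul (u : hat) : tens hat hat :=
  let: (c, f) := u in
  let one : hat := (0, (1 : bullet C)) in
    tlift (fun x y : C => tpure hat hat (x, 0) (y, 0)) (Delta c)
  + tpure hat hat one (c, f) + tpure hat hat (c, f) one
  - tpure hat hat (0, f) one.

Definition hat_counit (u : hat) : (bullet C)^o := u.2.
End Bold.

Record category := Category {
  obj :> Type;
  hom : obj -> obj -> Type;
  idm : forall X, hom X X;
  comp : forall X Y Z, hom Y Z -> hom X Y -> hom X Z;
  comp_idl : forall X Y (f : hom X Y), comp (idm Y) f = f;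
  comp_idr : forall X Y (f : hom X Y), comp f (idm X) = f;
  compA : forall X Y Z T (h : hom Z T) (g : hom Y Z) (f : hom X Y),
    comp h (comp g f) = comp (comp h g) f
}.
Arguments hom {c} X Y.
Arguments idm {c} X.
Arguments comp {c X Y Z} g f.

Record functor (K L : category) := Functor {
  fobj :> K -> L;
  fmap : forall X Y, hom X Y -> hom (fobj X) (fobj Y);
  fmap_id : forall X, fmap (idm X) = idm (fobj X);
  fmap_comp : forall X Y Z (g : hom Y Z) (f : hom X Y),
    fmap (comp g f) = comp (fmap g) (fmap f)
}.
Arguments fmap {K L} F {X Y} f : rename.

(* A morphism together with its source and target, so that morphisms between
   propositionally equal objects can be compared. *)
Definition arrow (K : category) : Type := {X : K & {Y : K & hom X Y}}.
Definition to_arrow (K : category) (X Y : K) (f : hom X Y) : arrow K :=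
  existT _ X (existT _ Y f).

(* Strict isomorphism: G o F and F o G are the identity functors. *)
Definition isomorphic_categories (K L : category) : Prop :=
  exists (F : functor K L) (G : functor L K),
    [/\ forall X : K, G (F X) = X,
        forall Y : L, F (G Y) = Y,
        forall (X X' : K) (f : hom X X'),
          to_arrow (fmap G (fmap F f)) = to_arrow f &
        forall (Y Y' : L) (f : hom Y Y'),
          to_arrow (fmap F (fmap G f)) = to_arrow f].

Section FullSubcategory.
Variables (K : category) (P : K -> Prop).
Definition full_subcategory : category :=
  @Category {X : K | P X} (fun X Y => hom (sval X) (sval Y))
    (fun X => idm (sval X)) (fun _ _ _ g f => comp g f)
    (fun X Y f => comp_idl f) (fun X Y f => comp_idr f)
    (fun _ _ _ _ h g f => compA h g f).
End FullSubcategory.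

(* Comodules and bicomodules, not necessarily counital.  They are defined for an
   arbitrary map Delta : C -> C (x)_A C and are meant for those satisfying
   is_coring. *)

Definition is_rcomodule (A : pzRingType) (C : bimodType A A)
    (Delta : C -> tens C C) (M : rmodType A) (rho : M -> tens M C) : Prop :=
  rlinear rho /\
  forall m, tmap id Delta (rho m) = tassoc (tmap rho id (rho m)).

Definition is_lcomodule (A : pzRingType) (C : bimodType A A)
    (Delta : C -> tens C C) (M : lmodType A) (rho : M -> tens C M) : Prop :=
  linear rho /\
  forall m, tassoc (tmap Delta id (rho m)) = tmap id rho (rho m).

Definition rcolinear (A : pzRingType) (C : bimodType A A) (M N : rmodType A)
    (rhoM : M -> tens M C) (rhoN : N -> tens N C) (f : M -> N) : Prop :=
  rlinear f /\ forall m, rhoN (f m) = tmap f id (rhoM m).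

Definition lcolinear (A : pzRingType) (C : bimodType A A) (M N : lmodType A)
    (rhoM : M -> tens C M) (rhoN : N -> tens C N) (f : M -> N) : Prop :=
  linear f /\ forall m, rhoN (f m) = tmap id f (rhoM m).

Definition rcounital (A : pzRingType) (C : bimodType A A) (eps : C -> A^o)
    (M : rmodType A) (rho : M -> tens M C) : Prop :=
  forall m, tlift (fun x c => x :* (eps c : A)) (rho m) = m.

Definition lcounital (A : pzRingType) (C : bimodType A A) (eps : C -> A^o)
    (M : lmodType A) (rho : M -> tens C M) : Prop :=
  forall m, tlift (fun c x => (eps c : A) *: x) (rho m) = m.

Record rcomodule (A : pzRingType) (C : bimodType A A)
    (Delta : C -> tens C C) := RComodule {
  rcomod_car :> rmodType A;
  rcomod_rho : rcomod_car -> tens rcomod_car C;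
  rcomodP : is_rcomodule Delta rcomod_rho
}.

Record lcomodule (A : pzRingType) (C : bimodType A A)
    (Delta : C -> tens C C) := LComodule {
  lcomod_car :> lmodType A;
  lcomod_rho : lcomod_car -> tens C lcomod_car;
  lcomodP : is_lcomodule Delta lcomod_rho
}.

(* Both coactions are maps of bimodules, so that all the maps in the last axiom
   (the compatibility of the two coactions) make sense. *)
Record bicomodule (B A : pzRingType)
    (D : bimodType B B) (DeltaD : D -> tens D D)
    (C : bimodType A A) (DeltaC : C -> tens C C) := Bicomodule {
  bicomod_car :> bimodType B A;
  bicomod_lrho : bicomod_car -> tens D bicomod_car;
  bicomod_rrho : bicomod_car -> tens bicomod_car C;
  bicomod_lrho_lin : bimod_linear bicomod_lrho;
  bicomod_rrho_lin : bimod_linear bicomod_rrho;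
  bicomod_lP : is_lcomodule DeltaD bicomod_lrho;
  bicomod_rP : is_rcomodule DeltaC bicomod_rrho;
  bicomod_compat : forall m,
    tassoc (tmap bicomod_lrho id (bicomod_rrho m)) =
    tmap id bicomod_rrho (bicomod_lrho m)
}.

Section ColinearComposition.
Variables (A : pzRingType) (C : bimodType A A).

Lemma tmap_id (M : rmodType A) (N : lmodType A) (t : tens M N) :
  tmap id id t = t.
Proof. exact: tlift_pure. Qed.

Lemma tmap_comp (M M' M'' : rmodType A) (N N' N'' : lmodType A)
    (f : M -> M') (f' : M' -> M'') (g : N -> N') (g' : N' -> N'') t :
  rlinear f' -> linear g' ->
  tmap (fun x => f' (f x)) (fun y => g' (g y)) t = tmap f' g' (tmap f g t).
Proof.
move=> f'l g'l; rewrite /tmap; have hb := tmap_balanced f'l g'l.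
rewrite [RHS]tlift_comp; last exact: tlift_additive.
by apply: eq_tlift => m n; rewrite tliftE.
Qed.

Lemma rcolinear_id (M : rmodType A) (rho : M -> tens M C) :
  rcolinear rho rho id.
Proof. by split=> // m; rewrite tmap_id. Qed.
Lemma rcolinear_comp (M N P : rmodType A) (rhoM : M -> tens M C)
    (rhoN : N -> tens N C) (rhoP : P -> tens P C) (g : N -> P) (f : M -> N) :
  rcolinear rhoN rhoP g -> rcolinear rhoM rhoN f ->
  rcolinear rhoM rhoP (fun x => g (f x)).
Proof.
move=> [gl gc] [fl fc]; split=> [a x y|m]; first by rewrite fl gl.
by rewrite gc fc -tmap_comp.
Qed.

Lemma lcolinear_id (M : lmodType A) (rho : M -> tens C M) :
  lcolinear rho rho id.
Proof. by split=> // m; rewrite tmap_id. Qed.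
Lemma lcolinear_comp (M N P : lmodType A) (rhoM : M -> tens C M)
    (rhoN : N -> tens C N) (rhoP : P -> tens C P) (g : N -> P) (f : M -> N) :
  lcolinear rhoN rhoP g -> lcolinear rhoM rhoN f ->
  lcolinear rhoM rhoP (fun x => g (f x)).
Proof.
move=> [gl gc] [fl fc]; split=> [a x y|m]; first by rewrite fl gl.
by rewrite gc fc -tmap_comp.
Qed.
End ColinearComposition.

Definition rcomod_cat (A : pzRingType) (C : bimodType A A)
    (Delta : C -> tens C C) : category.
Proof.
refine (@Category (rcomodule Delta)
  (fun M N => {f : M -> N | rcolinear (@rcomod_rho _ _ _ M) (@rcomod_rho _ _ _ N) f})
  (fun M => exist _ id (rcolinear_id _))
  (fun M N P g f => exist _ (fun x => sval g (sval f x))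
     (rcolinear_comp (svalP g) (svalP f))) _ _ _).
- by move=> M N [f fP]; apply: eq_exist.
- by move=> M N [f fP]; apply: eq_exist.
- by move=> M N P Q h g f; apply: eq_exist.
Defined.

Definition lcomod_cat (A : pzRingType) (C : bimodType A A)
    (Delta : C -> tens C C) : category.
Proof.
refine (@Category (lcomodule Delta)
  (fun M N => {f : M -> N | lcolinear (@lcomod_rho _ _ _ M) (@lcomod_rho _ _ _ N) f})
  (fun M => exist _ id (lcolinear_id _))
  (fun M N P g f => exist _ (fun x => sval g (sval f x))
     (lcolinear_comp (svalP g) (svalP f))) _ _ _).
- by move=> M N [f fP]; apply: eq_exist.
- by move=> M N [f fP]; apply: eq_exist.
- by move=> M N P Q h g f; apply: eq_exist.
Defined.

Definition bicolinear (B A : pzRingType)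
    (D : bimodType B B) (DeltaD : D -> tens D D)
    (C : bimodType A A) (DeltaC : C -> tens C C)
    (M N : bicomodule DeltaD DeltaC) (f : M -> N) : Prop :=
  lcolinear (@bicomod_lrho _ _ _ _ _ _ M) (@bicomod_lrho _ _ _ _ _ _ N) f /\
  rcolinear (@bicomod_rrho _ _ _ _ _ _ M) (@bicomod_rrho _ _ _ _ _ _ N) f.

Section BicomoduleCategory.
Variables (B A : pzRingType) (D : bimodType B B) (DeltaD : D -> tens D D).
Variables (C : bimodType A A) (DeltaC : C -> tens C C).
Implicit Types M N P : bicomodule DeltaD DeltaC.

Lemma bicolinear_id M : bicolinear (id : M -> M).
Proof. by split; [apply: lcolinear_id | apply: rcolinear_id]. Qed.
Lemma bicolinear_comp M N P (g : N -> P) (f : M -> N) :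
  bicolinear g -> bicolinear f -> bicolinear (fun x => g (f x)).
Proof.
move=> [gl gr] [fl fr].
by split; [apply: lcolinear_comp gl fl | apply: rcolinear_comp gr fr].
Qed.

Definition bicomod_cat : category.
Proof.
refine (@Category (bicomodule DeltaD DeltaC)
  (fun M N => {f : M -> N | bicolinear f})
  (fun M => exist _ id (bicolinear_id M))
  (fun M N P g f => exist _ (fun x => sval g (sval f x))
     (bicolinear_comp (svalP g) (svalP f))) _ _ _).
- by move=> M N [f fP]; apply: eq_exist.
- by move=> M N [f fP]; apply: eq_exist.
- by move=> M N P Q h g f; apply: eq_exist.
Defined.
End BicomoduleCategory.

Definition counital_rcomod_cat (A : pzRingType) (C : bimodType A A)
    (Delta : C -> tens C C) (eps : C -> A^o) : category :=
  @full_subcategory (rcomod_cat Delta)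
    (fun M => rcounital eps (@rcomod_rho _ _ _ M)).

Definition counital_lcomod_cat (A : pzRingType) (C : bimodType A A)
    (Delta : C -> tens C C) (eps : C -> A^o) : category :=
  @full_subcategory (lcomod_cat Delta)
    (fun M => lcounital eps (@lcomod_rho _ _ _ M)).

Definition counital_bicomod_cat (B A : pzRingType)
    (D : bimodType B B) (DeltaD : D -> tens D D) (epsD : D -> B^o)
    (C : bimodType A A) (DeltaC : C -> tens C C) (epsC : C -> A^o) : category :=
  @full_subcategory (bicomod_cat DeltaD DeltaC)
    (fun M => lcounital epsD (@bicomod_lrho _ _ _ _ _ _ M) /\
              rcounital epsC (@bicomod_rrho _ _ _ _ _ _ M)).

(* Main.v *)
(* Let C be a coring over A and H = C x A the bimodule obtained by adjoining a
   free generator 1 = (0, 1_A), which commutes with the scalars.  A map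
   r^ : M -> M (x) H splits into its components in M (x) C and M, and
   counitality says exactly that the second component is the identity:
   r^ m = r m + m (x) 1.  In both sides of the coassociativity law of r^, the
   terms in which 1 occurs agree, so r^ is coassociative iff r is; the same
   cancellation handles the compatibility of the two coactions of a bicomodule.
   A module map is colinear for r iff it is colinear for r^, so r <-> r^ is an
   isomorphism of categories that is the identity on underlying maps. *)
Require Import Defs.
From mathcomp Require Import all_boot all_algebra.
From mathcomp Require Import boolp.

Set Implicit Arguments.
Unset Strict Implicit.
Unset Printing Implicit Defensive.

Import Defs GRing.Theory.
Local Open Scope ring_scope.

(** * Linearity and naturality of maps between tensor products *)

Lemma ract0 (B : pzRingType) (M : rmodType B) (b : B) : (0 : M) :* b = 0.
Proof. by apply: (addrI ((0 : M) :* b)); rewrite -ractDl !addr0. Qed.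

Lemma ract0r (B : pzRingType) (M : rmodType B) (m : M) : m :* (0 : B) = 0.
Proof. by apply: (addrI (m :* (0 : B))); rewrite -ractDr !addr0. Qed.

Lemma tlift_tmap (A : pzRingType) (M M' : rmodType A) (N N' : lmodType A)
    (Z : zmodType) (h : M' -> N' -> Z) (f : M -> M') (g : N -> N') t :
  balanced h -> tlift h (tmap f g t) = tlift (fun m n => h (f m) (g n)) t.
Proof.
move=> hb; rewrite /tmap (@tlift_comp _ _ _ _ _ (tlift h)).
  by apply: eq_tlift => m n; rewrite tliftE.
exact: tlift_additive.
Qed.

Section TensorMaps.
Variable A : pzRingType.

Lemma tmap_additive (M M' : rmodType A) (N N' : lmodType A)
    (f : M -> M') (g : N -> N') : rlinear f -> linear g ->
  {morph tmap f g : s t / s + t}.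
Proof. by move=> fl gl; apply/tlift_additive/tmap_balanced. Qed.

Lemma tmapDl (M M' : rmodType A) (N N' : lmodType A)
    (f f' : M -> M') (g : N -> N') t :
  tmap (fun m => f m + f' m) g t = tmap f g t + tmap f' g t.
Proof.
have [hl _ _] := tpure_balanced M' N'.
by rewrite /tmap -tliftD; apply: eq_tlift => m n; apply: hl.
Qed.

Lemma tmapDr (M M' : rmodType A) (N N' : lmodType A)
    (f : M -> M') (g g' : N -> N') t :
  tmap f (fun n => g n + g' n) t = tmap f g t + tmap f g' t.
Proof.
have [_ hr _] := tpure_balanced M' N'.
by rewrite /tmap -tliftD; apply: eq_tlift => m n; apply: hr.
Qed.

Lemma eq_tmap (M M' : rmodType A) (N N' : lmodType A)
    (f f' : M -> M') (g g' : N -> N') t :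
  f =1 f' -> g =1 g' -> tmap f g t = tmap f' g' t.
Proof. by move=> ef eg; apply: eq_tlift => m n; rewrite ef eg. Qed.

Lemma tmap_linear (B : pzRingType) (M M' : bimodType B A) (N N' : lmodType A)
    (f : M -> M') (g : N -> N') : bimod_linear f -> linear g ->
  linear (tmap f g : tens M N -> tens M' N').
Proof.
move=> [fl fr] gl b s t; have D := tmap_additive fr gl.
rewrite D; congr (_ + _); move: s; apply: tens_ext => [u v|u v|m n].
- by rewrite scalerDr D.
- by rewrite D scalerDr.
- by rewrite scale_tpure !tmapE // (linear_scale fl) scale_tpure.
Qed.

Lemma tmap_rlinear (B : pzRingType) (M M' : rmodType A) (N N' : bimodType A B)
    (f : M -> M') (g : N -> N') : rlinear f -> bimod_linear g ->
  rlinear (tmap f g : tens M N -> tens M' N').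
Proof.
move=> fl [gl gr] b s t; have D := tmap_additive fl gl.
rewrite D; congr (_ + _); move: s; apply: tens_ext => [u v|u v|m n].
- by rewrite ractDl D.
- by rewrite D ractDl.
- by rewrite ract_tpure !tmapE // (rlinear_ract gr) ract_tpure.
Qed.

Lemma tmap_bilinear (B D : pzRingType) (M M' : bimodType B A)
    (N N' : bimodType A D) (f : M -> M') (g : N -> N') :
  bimod_linear f -> bimod_linear g ->
  bimod_linear (tmap f g : tens M N -> tens M' N').
Proof.
by move=> fl gl; split; [apply: tmap_linear => //; case: gl
                        |apply: tmap_rlinear => //; case: fl].
Qed.
End TensorMaps.

Lemma tassoc_additive (A B : pzRingType) (M : rmodType A) (N : bimodType A B)
    (P : lmodType B) : {morph @tassoc A B M N P : s t / s + t}.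
Proof. exact/tlift_additive/tassoc_balanced. Qed.

(** The middle map [g] is linear on both sides because [N] is tensored on both sides. By additivity
    it suffices to compare values on [t (x) p] and then, inside [t], on [(m (x) n) (x) p]. *)
Lemma tassoc_natural (A B : pzRingType) (M M' : rmodType A)
    (N N' : bimodType A B) (P P' : lmodType B)
    (f : M -> M') (g : N -> N') (h : P -> P') t :
  rlinear f -> bimod_linear g -> linear h ->
  tassoc (tmap (tmap f g) h t) = tmap f (tmap g h) (tassoc t).
Proof.
move=> fl gl hl; have [gl1 gl2] := gl.
have fgl : rlinear (tmap f g) by exact: tmap_rlinear.
have ghl : linear (tmap g h) by exact: tmap_linear.
have D1 := tmap_additive fgl hl; have D2 := tmap_additive fl ghl.
move: t; apply: tens_ext => [s t|s t|t p].
- by rewrite D1 tassoc_additive.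
- by rewrite tassoc_additive D2.
rewrite tmapE //; have [tl _ _] := tpure_balanced (tens M N) P.
have [tl' _ _] := tpure_balanced (tens M' N') P'.
move: t; apply: tens_ext => [s t|s t|m n].
- by rewrite tmap_additive // tl' tassoc_additive.
- by rewrite tl tassoc_additive D2.
- by rewrite tassocE !tmapE // tassocE.
Qed.

Section TensorPure.
Variables (B A : pzRingType) (X : rmodType B) (M : bimodType B A).

Lemma tpure_linear (N : lmodType A) (y : N) :
  linear (fun m : M => tpure M N m y).
Proof.
by have [hl _ _] := tpure_balanced M N; move=> b m m'; rewrite hl scale_tpure.
Qed.

Lemma tpure_rlinear (x : X) : rlinear (fun m : M => tpure X M x m).
Proof.
by have [_ hr _] := tpure_balanced X M; move=> a m m'; rewrite hr ract_tpure.
Qed.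

(** Serves tensors whose last factor is an adjoined unit; [tassoc_tmap_tpure] serves those whose
    first factor is one. *)
Lemma tassoc_tpure (N : lmodType A) (t : tens X M) (y : N) :
  tassoc (tpure (tens X M) N t y) = tmap id (fun m => tpure M N m y) t.
Proof.
have [hl _ _] := tpure_balanced (tens X M) N; have yl := tpure_linear y.
move: t; apply: tens_ext => [s t|s t|x m].
- by rewrite hl tassoc_additive.
- by rewrite tmap_additive.
- by rewrite tassocE tmapE.
Qed.

Lemma tassoc_tmap_tpure (N N' : lmodType A) (g : N -> N') (x : X)
    (t : tens M N) : linear g ->
  tassoc (tmap (fun m => tpure X M x m) g t)
  = tpure X (tens M N') x (tmap id g t).
Proof.
move=> gl; have [_ hr _] := tpure_balanced X (tens M N').
have xl := tpure_rlinear x.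
move: t; apply: tens_ext => [s t|s t|m n].
- by rewrite tmap_additive // tassoc_additive.
- by rewrite tmap_additive // hr.
- by rewrite !tmapE // tassocE.
Qed.
End TensorPure.

(** * Strict isomorphisms of categories from fully faithful functors *)

Lemma existT_inj2 (I : Type) (T : I -> Type) (i : I) :
  injective (existT T i).
Proof.
move=> x y e; have := projT2_eq e.
(* Proof irrelevance turns the equation [i = i] of first components into [erefl], so the transport
   in [projT2_eq] disappears. *)
by rewrite (Prop_irrelevance (projT1_eq e) erefl).
Qed.

Lemma to_arrow_inj (K : category) (X Y : K) : injective (@to_arrow K X Y).
Proof. by move=> f g e; apply: existT_inj2 (existT_inj2 e). Qed.

(** Allows composition up to propositional equality of the ends without transports: the equations of
    objects are eliminated one after the other, each elimination exposing the next equation. *)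
Lemma to_arrow_comp (K : category) (X Y Z X' Y' Z' : K)
    (f : hom X Y) (g : hom Y Z) (f' : hom X' Y') (g' : hom Y' Z') :
  to_arrow f = to_arrow f' -> to_arrow g = to_arrow g' ->
  to_arrow (comp g f) = to_arrow (comp g' f').
Proof.
move=> ef; have eX := projT1_eq ef; rewrite /= in eX; subst X'.
have ef1 := existT_inj2 ef; have eY := projT1_eq ef1; rewrite /= in eY.
subst Y'; have ef2 := existT_inj2 ef1; subst f'.
move=> eg; have eg1 := existT_inj2 eg; have eZ := projT1_eq eg1.
by rewrite /= in eZ; subst Z'; have eg2 := existT_inj2 eg1; subst g'.
Qed.

(** Fullness provides a lift of every arrow of [L], and faithfulness makes it unique. Functoriality
    of the inverse, and the law that it undoes [F] on arrows, follow from uniqueness; the other law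
    holds by the choice of the lift. *)
Lemma fully_faithful_isomorphic (K L : category) (F : functor K L) (G : L -> K) :
  (forall X, G (F X) = X) -> (forall Y, F (G Y) = Y) ->
  (forall X X', injective (@fmap _ _ F X X')) ->
  (forall X X' (k : hom (F X) (F X')), exists f, fmap F f = k) ->
  isomorphic_categories K L.
Proof.
move=> FK GK faithful full.
have lift (Y Y' : L) (k : hom Y Y') :
    {f : hom (G Y) (G Y') | to_arrow (fmap F f) = to_arrow k}.
  (* [k] is not literally an arrow between values of [F]; replacing [G Y] and [G Y'] by arbitrary
     preimages allows the equations of objects to be substituted. *)
  apply: cid; suff: forall X X', F X = Y -> F X' = Y' ->
      exists f : hom X X', to_arrow (fmap F f) = to_arrow k by exact.
  move=> X X' eX eX'; subst Y Y'.
  by have [f <-] := full _ _ k; exists f.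
have lift_uniq X X' (f f' : hom X X') :
    to_arrow (fmap F f) = to_arrow (fmap F f') -> f = f'.
  by move/to_arrow_inj/faithful.
pose Gm Y Y' (k : hom Y Y') := sval (lift _ _ k).
have GmK Y Y' (k : hom Y Y') : to_arrow (fmap F (Gm _ _ k)) = to_arrow k.
  exact: svalP (lift _ _ k).
have to_arrow_id (M : category) (X X' : M) : X = X' ->
    to_arrow (idm X) = to_arrow (idm X') by move=> ->.
have Gm_id Y : Gm _ _ (idm Y) = idm (G Y).
  by apply: lift_uniq; rewrite GmK fmap_id; apply: to_arrow_id.
have Gm_comp Y Y' Y'' (g : hom Y' Y'') (f : hom Y Y') :
    Gm _ _ (comp g f) = comp (Gm _ _ g) (Gm _ _ f).
  apply: lift_uniq; rewrite GmK fmap_comp.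
  by apply: to_arrow_comp; rewrite GmK.
exists F, (Functor Gm_id Gm_comp); split=> // X X' f /=.
(* The lift runs between [G (F X)] and [G (F X')], which equal [X] and [X'] only propositionally, so
   its ends are generalized before uniqueness is applied. *)
suff: forall Z Z' (h : hom Z Z'), Z = X -> Z' = X' ->
    to_arrow (fmap F h) = to_arrow (fmap F f) -> to_arrow h = to_arrow f.
  by apply; rewrite ?GmK.
by move=> Z Z' h eZ eZ'; subst Z Z' => /lift_uniq ->.
Qed.

(** * Adjoining a central unit to a bimodule; right coactions *)

Section UnitalExtension.
Variables (A : pzRingType) (C : bimodType A A).

(** Specializes to [hat] for the ring [bullet C] and the bimodule [bold C]; the comodule arguments
    can thus be given over an arbitrary ring. *)
Definition ext : bimodType A A := (C * A^o)%type.
Definition ext_in (c : C) : ext := (c, 0).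
Definition ext_out (u : ext) : C := u.1.
Definition ext_one : ext := (0, (1 : A)).
Definition ext_counit (u : ext) : A^o := u.2.

Lemma ext_in_bilinear : bimod_linear ext_in.
Proof.
split=> a x y; congr (_, _) => //=; first by rewrite scaler0 addr0.
by rewrite ract0 addr0.
Qed.

Lemma ext_out_bilinear : bimod_linear ext_out.
Proof. by []. Qed.

(** Both sides are [(0, a)]. Centrality lets a scalar pass through the adjoined unit, as in [(m a)
    (x) 1 = m (x) (a 1) = m (x) (1 a) = (m (x) 1) a]. *)
Lemma ext_one_central (a : A) : a *: ext_one = ext_one :* a.
Proof.
congr (_, _); first by rewrite /= scaler0 ract0.
by rewrite [LHS]mulr1 [RHS]mul1r.
Qed.

Lemma ext_split (u : ext) : u = ext_in (ext_out u) + (u.2 : A) *: ext_one.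
Proof.
case: u => c a; congr (_, _) => /=; first by rewrite scaler0 addr0.
by rewrite add0r [RHS]mulr1.
Qed.

Lemma rext_one_linear (M : rmodType A) :
  rlinear (fun m => tpure M ext m ext_one).
Proof.
have [hl hr hs] := tpure_balanced M ext.
by move=> a x y; rewrite hl hs ext_one_central ract_tpure.
Qed.

Lemma lext_one_linear (M : lmodType A) :
  linear (fun m => tpure ext M ext_one m).
Proof.
have [hl hr hs] := tpure_balanced ext M.
by move=> a x y; rewrite hr -hs -ext_one_central scale_tpure.
Qed.

Section Right.
Variables (M : rmodType A).
Implicit Types (m : M) (rho : M -> tens M C).

Definition rext rho m : tens M ext :=
  tmap id ext_in (rho m) + tpure M ext m ext_one.

Definition rres (rhoh : M -> tens M ext) m : tens M C :=
  tmap id ext_out (rhoh m).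

Lemma rextE rho : rres (rext rho) =1 rho.
Proof.
move=> m; rewrite /rres /rext.
have [_ hr _] := tpure_balanced M C.
rewrite tmap_additive // -tmap_comp // tmapE //.
rewrite (_ : tmap id _ (rho m) = rho m); last exact: tmap_id.
by rewrite (additive0 (hr m)) addr0.
Qed.

Let counit_balanced : balanced (fun (x : M) (u : ext) => x :* (u.2 : A)).
Proof.
by split=> [m m' n|m n n'|m a n]; [exact: ractDl | exact: ractDr | exact: ractA].
Qed.

(** A pure tensor [x (x) u] with [u = c + a 1] equals [x (x) c + (x a) (x) 1], and the elements
    [x a] arising from [rhoh m] add up to [m] by counitality. *)
Lemma rres_counital (rhoh : M -> tens M ext) :
  rcounital ext_counit rhoh -> rext (rres rhoh) =1 rhoh.
Proof.
have [il _] := ext_in_bilinear; have [ol _] := ext_out_bilinear.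
have [hl hr hs] := tpure_balanced M ext.
(* Writing the last [m] as the counit sum of [rhoh m] makes both sides additive in [rhoh m], which
   can then be taken to be a pure tensor. *)
move=> cu m; rewrite /rext /rres -[X in tpure M ext X _](cu m).
have D1 : {morph (tmap id ext_out : tens M ext -> tens M C) : s t / s + t}
  by exact: tmap_additive.
have D2 : {morph (tmap id ext_in : tens M C -> tens M ext) : s t / s + t}
  by exact: tmap_additive.
move: (rhoh m); apply: tens_ext => [s t|//|x u].
  by rewrite D1 D2 tlift_additive // hl addrACA.
by rewrite !tmapE // tliftE // hs -hr -ext_split.
Qed.

Lemma rext_counital rho : rcounital ext_counit (rext rho).
Proof.
move=> m; rewrite /rext tlift_additive // tliftE // ract1 tlift_tmap //.
rewrite [X in X + _](_ : _ = 0) ?add0r //; apply: big1 => -[x c] _ /=.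
exact: ract0r.
Qed.

Lemma rext_linear rho : rlinear rho -> rlinear (rext rho).
Proof.
move=> rl a x y; have iP := ext_in_bilinear; have [il _] := iP.
have irl : rlinear (tmap id ext_in : tens M C -> tens M ext).
  exact: tmap_rlinear.
by rewrite /rext rl irl rext_one_linear ractDl addrACA.
Qed.

Lemma rres_linear (rhoh : M -> tens M ext) : rlinear rhoh -> rlinear (rres rhoh).
Proof.
move=> rl a x y.
have orl : rlinear (tmap id ext_out : tens M ext -> tens M C).
  by apply: tmap_rlinear => //; apply: ext_out_bilinear.
by rewrite /rres rl orl.
Qed.

Lemma rext_linearE rho : rlinear (rext rho) <-> rlinear rho.
Proof.
split; last exact: rext_linear.
by move/rres_linear; rewrite (funext (rextE rho)).
Qed.

End Right.

(** Applying [f] to the first factor commutes with [ext_in] and [ext_out] on the second and sends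
    [m (x) 1] to [f m (x) 1]. The direction from [rext] to the original coactions projects by
    [rres]. *)
Lemma rext_natural (M N : rmodType A) (rho : M -> tens M C)
    (rho' : N -> tens N C) (f : M -> N) : rlinear f ->
  (forall m, rext rho' (f m) = tmap f id (rext rho m)) <->
  (forall m, rho' (f m) = tmap f id (rho m)).
Proof.
move=> fl; have [il _] := ext_in_bilinear; have [ol _] := ext_out_bilinear.
have fD : {morph (tmap f id : tens M ext -> tens N ext) : s t / s + t}
  by exact: tmap_additive.
split=> e m.
  rewrite -rextE /rres e -tmap_comp // -[in RHS](rextE rho m) /rres.
  by rewrite -tmap_comp.
by rewrite /rext fD tmapE // e -!tmap_comp.
Qed.
End UnitalExtension.

(** * The coring structure on the extended bimodule *)

Section UnitalExtensionCoring.
Variables (A : pzRingType) (C : bimodType A A) (Delta : C -> tens C C).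
Hypothesis Delta_lin : bimod_linear Delta.
Local Notation one := (ext_one C).
Local Notation iota := (@ext_in A C).
Local Notation H := (ext C).

Definition ext_lin (c : C) : tens H H := tpure H H one (iota c).
Definition ext_rin (c : C) : tens H H := tpure H H (iota c) one.

Definition ext_comul (u : H) : tens H H :=
  tmap iota iota (Delta u.1) + tpure H H one u + tpure H H u one
  - tpure H H (0, u.2) one.

Lemma ext_lin_bilinear : bimod_linear ext_lin.
Proof.
have [hl hr hs] := tpure_balanced H H; have [il ir] := ext_in_bilinear C.
split=> a x y; rewrite /ext_lin ?il ?ir hr ?ract_tpure //.
by rewrite -hs -ext_one_central scale_tpure.
Qed.

Lemma ext_rin_bilinear : bimod_linear ext_rin.
Proof.
have [hl hr hs] := tpure_balanced H H; have [il ir] := ext_in_bilinear C.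
split=> a x y; rewrite /ext_rin ?il ?ir hl ?scale_tpure //.
by rewrite hs ext_one_central ract_tpure.
Qed.

Lemma tmap_ext_bilinear :
  bimod_linear (tmap iota iota : tens C C -> tens H H).
Proof. by apply: tmap_bilinear; apply: ext_in_bilinear. Qed.

(** With [u = c + a 1], both [1 (x) u] and [u (x) 1] contribute the term [a (1 (x) 1)], and the
    subtracted term removes one copy. In the resulting form each summand is bilinear by itself. *)
Lemma ext_comulE u : ext_comul u =
  tmap iota iota (Delta u.1) + ext_lin u.1 + ext_rin u.1
  + (u.2 : A) *: tpure H H one one.
Proof.
have [hl hr hs] := tpure_balanced H H.
have eu := ext_split u; rewrite /ext_comul.
have -> : tpure H H one u = ext_lin u.1 + (u.2 : A) *: tpure H H one one.
  by rewrite [X in tpure H H one X]eu hr -hs -ext_one_central -scale_tpure.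
have -> : tpure H H u one = ext_rin u.1 + tpure H H (0, u.2) one.
  rewrite -hl; congr tpure; case: (u) => c a.
  by congr (_, _); rewrite /= ?addr0 ?add0r.
by rewrite addrA addrK -!addrA; congr (_ + (_ + _)); apply: addrC.
Qed.

Lemma ext_comul_in c :
  ext_comul (iota c) = tmap iota iota (Delta c) + ext_lin c + ext_rin c.
Proof. by rewrite ext_comulE /= scale0r addr0. Qed.

Lemma ext_comul_one : ext_comul one = tpure H H one one.
Proof.
have [il ir] := tmap_ext_bilinear; have [dl _] := Delta_lin.
have [ll _] := ext_lin_bilinear; have [rl _] := ext_rin_bilinear.
rewrite ext_comulE scale1r /= (additive0 (linear_additive dl)).
rewrite (additive0 (linear_additive il)) (additive0 (linear_additive ll)).
by rewrite (additive0 (linear_additive rl)) !add0r.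
Qed.

Lemma ext_comul_bilinear : bimod_linear ext_comul.
Proof.
have [_ _ hs] := tpure_balanced H H.
have [il ir] := tmap_ext_bilinear; have [dl dr] := Delta_lin.
have [ll lr] := ext_lin_bilinear; have [rl rr] := ext_rin_bilinear.
split=> a x y; rewrite !ext_comulE /=.
  rewrite dl il ll rl scalerDl -scalerA !scalerDr.
  by do 3!(rewrite [RHS]addrACA; congr (_ + _)).
(* A scalar passes through each of the two units in turn. *)
have oneR : (a *: tpure H H one one) = tpure H H one one :* a.
  by rewrite ract_tpure -ext_one_central -hs -ext_one_central scale_tpure.
rewrite dr ir lr rr scalerDl !ractDl bimodA -oneR scalerA.
by do 3!(rewrite [RHS]addrACA; congr (_ + _)).
Qed.

Lemma ext_counitP : is_counit ext_comul (@ext_counit A C).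
Proof.
have [il ir] := ext_in_bilinear C.
have lb : balanced (fun x y : H => (x.2 : A) *: y).
  split=> [m m' n|m n n'|m a n]; [exact: scalerDl | exact: scalerDr|].
  by rewrite scalerA.
have rb : balanced (fun x y : H => x :* (y.2 : A)).
  split=> [m m' n|m n n'|m a n]; [exact: ractDl | exact: ractDr | exact: ractA].
split=> // u; rewrite ext_comulE scale_tpure; split.
  (* The counit vanishes on the image of [iota], so the image of [Delta] and the term [c (x) 1]
     contribute 0; [1 (x) c] gives [c], and the last term gives the multiple of the unit in [u]. *)
  rewrite !(tlift_additive lb) /ext_lin /ext_rin !tliftE //.
  rewrite tlift_tmap // [X in X + _ + _ + _](_ : _ = 0); last first.
    by apply: big1 => p _ /=; rewrite scale0r.
  have -> : ((u.2 : A) *: one).2 = u.2 by exact: mulr1.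
  by rewrite add0r scale1r scale0r addr0 -ext_split.
rewrite !(tlift_additive rb) /ext_lin /ext_rin !tliftE //.
rewrite tlift_tmap // [X in X + _ + _ + _](_ : _ = 0); last first.
  by apply: big1 => p _ /=; rewrite ract0r.
by rewrite add0r ract1 ract0r add0r ract1 -ext_split.
Qed.

(** A unit in the middle can be attached to the factor on either side. Together with [tassoc_rin]
    (unit last) and [tassoc_lin] (unit first) this covers the positions of a single unit in a triple
    tensor. *)
Lemma tassoc_tmap_one (M M' : rmodType A) (N N' : lmodType A)
    (f : M -> M') (g : N -> N') (t : tens M N) : rlinear f -> linear g ->
  tassoc (tmap (fun m => tpure M' H (f m) one) g t)
  = tmap f (fun n => tpure H N' one (g n)) t.
Proof.
move=> fl gl.
have fl1 : rlinear (fun m => tpure M' H (f m) one).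
  by move=> a x y; rewrite fl rext_one_linear.
have gl1 : linear (fun n => tpure H N' one (g n)).
  by move=> a x y; rewrite gl lext_one_linear.
move: t; apply: tens_ext => [s t|s t|m n].
- by rewrite tmap_additive // tassoc_additive.
- by rewrite tmap_additive.
- by rewrite !tmapE // tassocE.
Qed.

Lemma tassoc_rin (M M' : rmodType A) (f : M -> M') (t : tens M C) :
  tassoc (tpure (tens M' H) H (tmap f iota t) one) = tmap f ext_rin t.
Proof. by rewrite tassoc_tpure -tmap_comp //; apply: tpure_linear. Qed.

Lemma tassoc_lin (N N' : lmodType A) (g : N -> N') (t : tens C N) :
  linear g ->
  tassoc (tmap ext_lin g t) = tpure H (tens H N') one (tmap iota g t).
Proof.
move=> gl; rewrite -[tmap ext_lin g t]/
  (tmap (fun c => tpure H H one (iota c)) (fun n => g n) t).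
rewrite (@tmap_comp _ _ _ _ _ _ _ iota (tpure H H one) id g) //; last exact: tpure_rlinear.
by rewrite tassoc_tmap_tpure // -tmap_comp.
Qed.
End UnitalExtensionCoring.

Arguments ext_lin {A C} c.
Arguments ext_rin {A C} c.

(** * Coassociativity of the extension; right comodules *)

Section Coassociativity.
Variables (A : pzRingType) (C : bimodType A A) (Delta : C -> tens C C).
Hypothesis Delta_lin : bimod_linear Delta.
Local Notation one := (ext_one C).
Local Notation iota := (@ext_in A C).
Local Notation pi := (@ext_out A C).
Local Notation H := (ext C).
Local Notation DeltaH := (ext_comul Delta).

Lemma tmap_ext_comul_in (M M' : rmodType A) (f : M -> M') (t : tens M C) :
  rlinear f ->
  tmap id DeltaH (tmap f iota t) =
  tmap f (tmap iota iota) (tmap id Delta t)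
  + tmap f ext_lin t + tmap f ext_rin t.
Proof.
move=> fl; have [dl _] := ext_comul_bilinear Delta_lin.
have [il _] := tmap_ext_bilinear C.
rewrite -!tmap_comp // -!tmapDr.
by apply: eq_tmap => // c; apply: ext_comul_in.
Qed.

Lemma ext_comul_in_tmap (N N' : lmodType A) (g : N -> N') (t : tens C N) :
  linear g ->
  tmap DeltaH id (tmap iota g t) =
  tmap (tmap iota iota) g (tmap Delta id t)
  + tmap ext_lin g t + tmap ext_rin g t.
Proof.
move=> fl; have [_ dl] := ext_comul_bilinear Delta_lin.
have [_ il] := tmap_ext_bilinear C.
rewrite -!tmap_comp // -!tmapDl.
by apply: eq_tmap => // c; apply: ext_comul_in.
Qed.

(** The multiple [a 1] in [u] yields [a (1 (x) 1 (x) 1)] on both sides. The component [c] yields the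
    iterated [Delta] and one term for each placement of one or two units among the three factors;
    these agree as well. *)
Lemma ext_comul_coassoc : coassociative Delta -> coassociative DeltaH.
Proof.
have iP := ext_in_bilinear C; have [il ir] := iP.
have [dl dr] := ext_comul_bilinear Delta_lin.
have [_ hr _] := tpure_balanced H (tens H H).
have [hl _ _] := tpure_balanced (tens H H) H.
have DD : {morph (tmap DeltaH id : tens H H -> tens (tens H H) H) : s t / s + t}.
  exact: tmap_additive.
have DD' : {morph (tmap id DeltaH : tens H H -> tens H (tens H H)) : s t / s + t}.
  exact: tmap_additive.
have aD := @tassoc_additive A A H H H.
move=> Da u; rewrite ext_comulE // scale_tpure !DD !DD' !aD.
congr (_ + _); last first.
  rewrite !tmapE // (linear_scale dl) ext_comul_one // scale_tpure.
  by rewrite tassocE.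
rewrite ext_comul_in_tmap // tmap_ext_comul_in // !aD tassoc_natural //.
rewrite Da tassoc_lin // tassoc_tmap_one // [in LHS]/ext_lin [in LHS]/ext_rin.
rewrite !tmapE // ext_comul_one // ext_comul_in // !hl !aD tassoc_rin.
rewrite !tassocE !hr !addrA.
(* With [c] for a factor from [C], the terms on the left are in the order
   [ccc, 1cc, c1c, 11c, cc1, 1c1, c11], those on the right in the order
   [ccc, c1c, cc1, 1cc, 11c, 1c1, c11]. *)
by rewrite [LHS](ACl (1*3*5*2*4*6*7))%AC.
Qed.

Section RightComodules.
Variables (M : rmodType A) (rho : M -> tens M C).
Hypothesis rho_lin : rlinear rho.

(* The terms of either side of the coassociativity law of [rext rho] in which
   the adjoined unit occurs; they cancel. *)
Definition runit_part m : tens M (tens H H) :=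
  tmap id ext_lin (rho m) + tmap id ext_rin (rho m)
  + tpure M (tens H H) m (tpure H H one one).

Lemma tmap_comul_rext m : tmap id DeltaH (rext rho m) =
  tmap id (tmap iota iota) (tmap id Delta (rho m)) + runit_part m.
Proof.
have [dl _] := ext_comul_bilinear Delta_lin.
rewrite /rext tmap_additive // tmapE // ext_comul_one //.
by rewrite tmap_ext_comul_in // /runit_part !addrA.
Qed.

Lemma tassoc_tmap_rext m : tassoc (tmap (rext rho) id (rext rho m)) =
  tmap id (tmap iota iota) (tassoc (tmap rho id (rho m))) + runit_part m.
Proof.
have iP := ext_in_bilinear C; have [il ir] := iP.
have rhl := rext_linear rho_lin.
have [hl _ _] := tpure_balanced (tens M H) H.
have irl : rlinear (tmap id iota : tens M C -> tens M H) by exact: tmap_rlinear.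
rewrite {2}/rext tmap_additive // tmapE // tassoc_additive {2}/rext.
rewrite hl tassoc_additive tassocE tassoc_rin -tmap_comp // tmapDl.
rewrite tassoc_additive tassoc_tmap_one // -tassoc_natural //.
by rewrite -tmap_comp // /runit_part !addrA.
Qed.
End RightComodules.

Lemma tmap_ext_out2 (t : tens C C) : tmap pi pi (tmap iota iota t) = t.
Proof. by rewrite -tmap_comp // tmap_id. Qed.

(** Each side of the law for [rext rho] is the image of the corresponding side for [rho] plus the
    common [runit_part], which cancels. Tensoring need not preserve injections, so injectivity of
    the embedding is drawn from the retraction [pi] of [iota]. *)
Lemma rext_comoduleE (M : rmodType A) (rho : M -> tens M C) :
  is_rcomodule DeltaH (rext rho) <-> is_rcomodule Delta rho.
Proof.
have inj : injective (tmap id (tmap iota iota)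
    : tens M (tens C C) -> tens M (tens H H)).
  apply: (can_inj (g := tmap id (tmap pi pi))) => t.
  rewrite -tmap_comp //; last exact: tmap_linear.
  by rewrite -[RHS]tmap_id; apply: eq_tmap => // u; apply: tmap_ext_out2.
rewrite /is_rcomodule rext_linearE; split=> -[rl e]; split=> // m.
  apply: inj; apply: (addIr (runit_part rho m)).
  by rewrite -tmap_comul_rext // -tassoc_tmap_rext.
by rewrite tmap_comul_rext // tassoc_tmap_rext // e.
Qed.
End Coassociativity.

(** * Left coactions, mirroring the right ones *)

Section LeftCoactions.
Variables (A : pzRingType) (C : bimodType A A).
Local Notation one := (ext_one C).
Local Notation iota := (@ext_in A C).
Local Notation pi := (@ext_out A C).
Local Notation H := (ext C).

Section Coaction.
Variables (M : lmodType A).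
Implicit Types (m : M) (rho : M -> tens C M).

Definition lext rho m : tens H M :=
  tmap iota id (rho m) + tpure H M one m.

Definition lres (rhoh : M -> tens H M) m : tens C M :=
  tmap pi id (rhoh m).

Lemma lextE rho : lres (lext rho) =1 rho.
Proof.
move=> m; rewrite /lres /lext; have [_ ir] := ext_in_bilinear C.
have [hl _ _] := tpure_balanced C M.
rewrite tmap_additive // -tmap_comp // tmapE //.
rewrite (_ : tmap _ id (rho m) = rho m); last exact: tmap_id.
by rewrite (additive0 (fun x y => hl x y m)) addr0.
Qed.

Let counit_balanced : balanced (fun (u : H) (x : M) => (u.2 : A) *: x).
Proof.
split=> [m m' n|m n n'|m a n]; [exact: scalerDl | exact: scalerDr|].
by rewrite scalerA.
Qed.

Lemma lres_counital (rhoh : M -> tens H M) :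
  lcounital (@ext_counit A C) rhoh -> lext (lres rhoh) =1 rhoh.
Proof.
have [_ ir] := ext_in_bilinear C; have [_ or] := ext_out_bilinear C.
have [hl hr hs] := tpure_balanced H M.
move=> cu m; rewrite /lext /lres -[X in tpure H M _ X](cu m).
have D1 : {morph (tmap pi id : tens H M -> tens C M) : s t / s + t}.
  exact: tmap_additive.
have D2 : {morph (tmap iota id : tens C M -> tens H M) : s t / s + t}.
  exact: tmap_additive.
move: (rhoh m); apply: tens_ext => [s t|//|u x].
  by rewrite D1 D2 tlift_additive // hr addrACA.
(* The scalar [u.2] arrives on the right of the unit and is moved to its left by centrality, as
   [ext_split] requires. *)
by rewrite !tmapE // tliftE // -hs -hl -ext_one_central -ext_split.
Qed.

Lemma lext_counital rho : lcounital (@ext_counit A C) (lext rho).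
Proof.
move=> m; rewrite /lext tlift_additive // tliftE // scale1r tlift_tmap //.
rewrite [X in X + _](_ : _ = 0) ?add0r //; apply: big1 => -[x c] _ /=.
exact: scale0r.
Qed.

Lemma lext_linear rho : linear rho -> linear (lext rho).
Proof.
move=> rl a x y; have iP := ext_in_bilinear C.
have ill : linear (tmap iota id : tens C M -> tens H M) by exact: tmap_linear.
by rewrite /lext rl ill lext_one_linear scalerDr addrACA.
Qed.

Lemma lres_linear (rhoh : M -> tens H M) : linear rhoh -> linear (lres rhoh).
Proof.
move=> rl a x y.
have orl : linear (tmap pi id : tens H M -> tens C M).
  by apply: tmap_linear => //; apply: ext_out_bilinear.
by rewrite /lres rl orl.
Qed.

Lemma lext_linearE rho : linear (lext rho) <-> linear rho.
Proof.
split; last exact: lext_linear.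
by move/lres_linear; rewrite (funext (lextE rho)).
Qed.
End Coaction.

Lemma lext_natural (M N : lmodType A) (rho : M -> tens C M)
    (rho' : N -> tens C N) (f : M -> N) : linear f ->
  (forall m, lext rho' (f m) = tmap id f (lext rho m)) <->
  (forall m, rho' (f m) = tmap id f (rho m)).
Proof.
move=> fl; have [_ ir] := ext_in_bilinear C; have [_ or] := ext_out_bilinear C.
have fD : {morph (tmap id f : tens H M -> tens H N) : s t / s + t}.
  exact: tmap_additive.
split=> e m.
  rewrite -lextE /lres e -tmap_comp // -[in RHS](lextE rho m) /lres.
  by rewrite -tmap_comp.
by rewrite /lext fD tmapE // e -!tmap_comp.
Qed.

Section Comodules.
Variable Delta : C -> tens C C.
Hypothesis Delta_lin : bimod_linear Delta.
Local Notation DeltaH := (ext_comul Delta).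

Section LeftComodules.
Variables (M : lmodType A) (rho : M -> tens C M).
Hypothesis rho_lin : linear rho.

(** The left counterpart of [runit_part]: the terms with the unit that both sides of the
    coassociativity law of [lext rho] share. *)
Definition lunit_part m : tens H (tens H M) :=
  tpure H (tens H M) one (tmap iota id (rho m))
  + tmap iota (fun n => tpure H M one n) (rho m)
  + tpure H (tens H M) one (tpure H M one m).

Lemma tassoc_tmap_comul_lext m : tassoc (tmap DeltaH id (lext rho m)) =
  tmap iota (tmap iota id) (tassoc (tmap Delta id (rho m))) + lunit_part m.
Proof.
have iP := ext_in_bilinear C; have [il ir] := iP.
have [_ dr] := ext_comul_bilinear Delta_lin.
rewrite /lext tmap_additive // tmapE // ext_comul_one // ext_comul_in_tmap //.
rewrite !tassoc_additive tassocE tassoc_lin // tassoc_tmap_one //.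
by rewrite tassoc_natural // /lunit_part !addrA.
Qed.

Lemma tmap_lext m : tmap id (lext rho) (lext rho m) =
  tmap iota (tmap iota id) (tmap id rho (rho m)) + lunit_part m.
Proof.
have iP := ext_in_bilinear C; have [il ir] := iP.
have lhl := lext_linear rho_lin.
have [_ hr _] := tpure_balanced H (tens H M).
have ill : linear (tmap iota id : tens C M -> tens H M) by exact: tmap_linear.
rewrite {2}/lext tmap_additive // tmapE // {2}/lext hr -tmap_comp // tmapDr.
rewrite -tmap_comp // /lunit_part -!addrA; congr (_ + _).
by rewrite addrCA.
Qed.
End LeftComodules.

(** The cancellation argument of [rext_comoduleE], with [iota] on the two left factors and [pi] on
    them as retraction. *)
Lemma lext_comoduleE (M : lmodType A) (rho : M -> tens C M) :
  is_lcomodule DeltaH (lext rho) <-> is_lcomodule Delta rho.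
Proof.
have iP := ext_in_bilinear C; have [il ir] := iP.
have pl : linear (tmap pi id : tens H M -> tens C M) by exact: tmap_linear.
have inj : injective (tmap iota (tmap iota id)
    : tens C (tens C M) -> tens H (tens H M)).
  apply: (can_inj (g := tmap pi (tmap pi id))) => t.
  rewrite -tmap_comp // -[RHS]tmap_id; apply: eq_tmap => // u.
  by rewrite -tmap_comp // tmap_id.
rewrite /is_lcomodule lext_linearE; split=> -[rl e]; split=> // m.
  apply: inj; apply: (addIr (lunit_part rho m)).
  by rewrite -tmap_lext // -tassoc_tmap_comul_lext //; apply: e.
by rewrite tmap_lext // tassoc_tmap_comul_lext // e.
Qed.
End Comodules.
End LeftCoactions.

(** * Coactions on bimodules and their compatibility *)

Section Bicoactions.
Variables (B A : pzRingType) (D : bimodType B B) (C : bimodType A A).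
Variables (M : bimodType B A).
Implicit Types (lam : M -> tens D M) (rho : M -> tens M C).

Lemma lext_bilinear lam : bimod_linear lam ->
  bimod_linear (lext lam : M -> tens (ext D) M).
Proof.
move=> [ll lr]; split; first exact: lext_linear.
have iP := ext_in_bilinear D.
have irl : rlinear (tmap (@ext_in B D) id : tens D M -> tens (ext D) M).
  by apply: tmap_rlinear => //; case: iP.
move=> a x y; rewrite /lext lr irl (tpure_rlinear (ext_one D)).
by rewrite ractDl addrACA.
Qed.

Lemma lres_bilinear (lamh : M -> tens (ext D) M) : bimod_linear lamh ->
  bimod_linear (lres lamh : M -> tens D M).
Proof.
move=> [ll lr]; split; first exact: lres_linear.
have oP := ext_out_bilinear D.
have orl : rlinear (tmap (@ext_out B D) id : tens (ext D) M -> tens D M).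
  by apply: tmap_rlinear => //; case: oP.
by move=> a x y; rewrite /lres lr orl.
Qed.

Lemma rext_bilinear rho : bimod_linear rho ->
  bimod_linear (rext rho : M -> tens M (ext C)).
Proof.
move=> [rl rr]; split; last exact: rext_linear.
have [il _] := ext_in_bilinear C.
have ill : linear (tmap id (@ext_in A C) : tens M C -> tens M (ext C)).
  exact: tmap_linear.
move=> b x y; rewrite /rext rl ill (tpure_linear (ext_one C)).
by rewrite scalerDr addrACA.
Qed.

Lemma rres_bilinear (rhoh : M -> tens M (ext C)) : bimod_linear rhoh ->
  bimod_linear (rres rhoh : M -> tens M C).
Proof.
move=> [rl rr]; split; last exact: rres_linear.
have [ol _] := ext_out_bilinear C.
have orl : linear (tmap id (@ext_out A C) : tens M (ext C) -> tens M C).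
  exact: tmap_linear.
by move=> b x y; rewrite /rres rl orl.
Qed.

Lemma ext_compatE lam rho : bimod_linear lam -> bimod_linear rho ->
  (forall m, tassoc (tmap (lext lam) id (rext rho m))
             = tmap id (rext rho) (lext lam m)) <->
  (forall m, tassoc (tmap lam id (rho m)) = tmap id rho (lam m)).
Proof.
move=> lP rP; have [lhl lhr] := lext_bilinear lP.
have [rhl rhr] := rext_bilinear rP; have [ll lr] := lP; have [rl rr] := rP.
set iD := @ext_in B D; set iC := @ext_in A C.
set oneD := ext_one D; set oneC := ext_one C.
have [iDl iDr] : bimod_linear iD by exact: ext_in_bilinear.
have [iCl iCr] : bimod_linear iC by exact: ext_in_bilinear.
have [_ hr _] := tpure_balanced (ext D) (tens M (ext C)).
have [hl _ _] := tpure_balanced (tens (ext D) M) (ext C).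
have idP : bimod_linear (id : M -> M) by [].
have iDll : rlinear (tmap iD id : tens D M -> tens (ext D) M).
  exact: tmap_rlinear.
have iCll : linear (tmap id iC : tens M C -> tens M (ext C)).
  exact: tmap_linear.
(* The terms containing a unit of either extension, common to both sides: [1 (x) rho m],
   [lam m (x) 1] and [1 (x) m (x) 1]. *)
pose E m := tpure (ext D) (tens M (ext C)) oneD (tmap id iC (rho m))
  + tmap iD (fun n => tpure M (ext C) n oneC) (lam m)
  + tpure (ext D) (tens M (ext C)) oneD (tpure M (ext C) m oneC).
have lE m : tassoc (tmap (lext lam) id (rext rho m)) =
    tmap iD (tmap id iC) (tassoc (tmap lam id (rho m))) + E m.
  rewrite {1}/rext tmap_additive // tmapE // -tmap_comp // tmapDl.
  rewrite !tassoc_additive tassoc_tmap_tpure // {1}/lext hl tassoc_additive.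
  rewrite tassocE tassoc_tpure -tmap_comp //; last exact: tpure_linear.
  by rewrite -tassoc_natural // -tmap_comp // /E !addrA.
have rE m : tmap id (rext rho) (lext lam m) =
    tmap iD (tmap id iC) (tmap id rho (lam m)) + E m.
  rewrite {1}/lext tmap_additive // tmapE // -tmap_comp // tmapDr.
  rewrite {1}/rext hr -tmap_comp // /E -!addrA; congr (_ + _).
  by rewrite addrCA.
(* Once [E m] is cancelled, the original law is recovered by the projections [ext_out] on the two
   outer factors. *)
have inj : injective (tmap iD (tmap id iC)
    : tens D (tens M C) -> tens (ext D) (tens M (ext C))).
  have pl : linear (tmap id (@ext_out A C) : tens M (ext C) -> tens M C).
    exact: tmap_linear.
  apply: (can_inj (g := tmap (@ext_out B D) (tmap id (@ext_out A C)))) => t.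
  rewrite -tmap_comp // -[RHS]tmap_id; apply: eq_tmap => // u.
  by rewrite -tmap_comp // tmap_id.
split=> e m; last by rewrite lE rE e.
by apply: inj; apply: (addIr (E m)); rewrite -lE -rE; apply: e.
Qed.
End Bicoactions.

(** * Isomorphisms of the categories of one-sided comodules *)

Section Isomorphisms.
Variables (A : pzRingType) (C : bimodType A A) (Delta : C -> tens C C).
Hypothesis Delta_lin : bimod_linear Delta.
Local Notation DeltaH := (ext_comul Delta).

(** Serves the strict identities [G (F X) = X] and [F (G Y) = Y]: the carriers coincide, so only
    coactions are to be compared, the axioms being proof irrelevant. *)
Lemma rcomodule_eq (M : rmodType A) (E : bimodType A A) (DeltaE : E -> tens E E)
    (rho rho' : M -> tens M E) (p : is_rcomodule DeltaE rho)
    (p' : is_rcomodule DeltaE rho') :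
  rho =1 rho' -> RComodule p = RComodule p'.
Proof. by move/funext=> e; subst rho'; rewrite (Prop_irrelevance p p'). Qed.

Lemma lcomodule_eq (M : lmodType A) (E : bimodType A A) (DeltaE : E -> tens E E)
    (rho rho' : M -> tens E M) (p : is_lcomodule DeltaE rho)
    (p' : is_lcomodule DeltaE rho') :
  rho =1 rho' -> LComodule p = LComodule p'.
Proof. by move/funext=> e; subst rho'; rewrite (Prop_irrelevance p p'). Qed.

Lemma rcomod_isomorphic :
  isomorphic_categories (rcomod_cat Delta)
    (counital_rcomod_cat DeltaH (@ext_counit A C)).
Proof.
set K := rcomod_cat Delta; set L := counital_rcomod_cat _ _.
pose F0 (X : K) : L := exist (fun Y : rcomod_cat DeltaH =>
    rcounital (@ext_counit A C) (@rcomod_rho _ _ _ Y))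
  (RComodule ((rext_comoduleE Delta_lin (@rcomod_rho _ _ _ X)).2 (rcomodP X)))
  (rext_counital (@rcomod_rho _ _ _ X)).
(* The same maps are colinear before and after the extension, so [F] can keep underlying maps and is
   fully faithful. *)
have homE (X X' : K) (f : X -> X') :
    rcolinear (@rcomod_rho _ _ _ X) (@rcomod_rho _ _ _ X') f <->
    rcolinear (rext (@rcomod_rho _ _ _ X)) (rext (@rcomod_rho _ _ _ X')) f.
  by split=> -[fl e]; split=> //; apply/rext_natural.
pose F1 (X X' : K) (f : hom X X') : hom (F0 X) (F0 X') :=
  exist _ (sval f) ((homE X X' _).1 (svalP f)).
have F1id X : F1 X X (idm X) = idm (F0 X) by apply: eq_exist.
have F1comp X Y Z (g : hom Y Z) (f : hom X Y) :
    F1 _ _ (comp g f) = comp (F1 _ _ g) (F1 _ _ f) by apply: eq_exist.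
(* Counitality gives back the coaction of [Y] as [rext] of its [rres], so the comodule axioms for
   [rres] follow from those of [Y]. *)
have GP (Y : L) : is_rcomodule Delta (rres (@rcomod_rho _ _ _ (sval Y))).
  by apply/rext_comoduleE; rewrite // (funext (rres_counital (svalP Y)));
     apply: rcomodP.
apply: (@fully_faithful_isomorphic K L (Functor F1id F1comp)
          (fun Y => RComodule (GP Y))) => /=.
- by move=> [M rho rhoP]; apply: rcomodule_eq; apply: rextE.
- move=> [[M rho rhoP] cu]; apply: eq_exist; apply: rcomodule_eq => m.
  exact: rres_counital.
- by move=> X X' [f fP] [g gP] /(congr1 sval) e; apply: eq_exist.
- move=> X X' [f fP]; exists (exist _ f ((homE X X' f).2 fP)).
  exact: eq_exist.
Qed.

Lemma lcomod_isomorphic :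
  isomorphic_categories (lcomod_cat Delta)
    (counital_lcomod_cat DeltaH (@ext_counit A C)).
Proof.
set K := lcomod_cat Delta; set L := counital_lcomod_cat _ _.
pose F0 (X : K) : L := exist (fun Y : lcomod_cat DeltaH =>
    lcounital (@ext_counit A C) (@lcomod_rho _ _ _ Y))
  (LComodule ((lext_comoduleE Delta_lin (@lcomod_rho _ _ _ X)).2 (lcomodP X)))
  (lext_counital (@lcomod_rho _ _ _ X)).
have homE (X X' : K) (f : X -> X') :
    lcolinear (@lcomod_rho _ _ _ X) (@lcomod_rho _ _ _ X') f <->
    lcolinear (lext (@lcomod_rho _ _ _ X)) (lext (@lcomod_rho _ _ _ X')) f.
  by split=> -[fl e]; split=> //; apply/lext_natural.
pose F1 (X X' : K) (f : hom X X') : hom (F0 X) (F0 X') :=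
  exist _ (sval f) ((homE X X' _).1 (svalP f)).
have F1id X : F1 X X (idm X) = idm (F0 X) by apply: eq_exist.
have F1comp X Y Z (g : hom Y Z) (f : hom X Y) :
    F1 _ _ (comp g f) = comp (F1 _ _ g) (F1 _ _ f) by apply: eq_exist.
have GP (Y : L) : is_lcomodule Delta (lres (@lcomod_rho _ _ _ (sval Y))).
  by apply/lext_comoduleE; rewrite // (funext (lres_counital (svalP Y)));
     apply: lcomodP.
apply: (@fully_faithful_isomorphic K L (Functor F1id F1comp)
          (fun Y => LComodule (GP Y))) => /=.
- by move=> [M rho rhoP]; apply: lcomodule_eq; apply: lextE.
- move=> [[M rho rhoP] cu]; apply: eq_exist; apply: lcomodule_eq => m.
  exact: lres_counital.
- by move=> X X' [f fP] [g gP] /(congr1 sval) e; apply: eq_exist.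
- move=> X X' [f fP]; exists (exist _ f ((homE X X' f).2 fP)).
  exact: eq_exist.
Qed.
End Isomorphisms.

(** * Isomorphism of the categories of bicomodules *)

Section BicomoduleIsomorphism.
Variables (B A : pzRingType) (D : bimodType B B) (DeltaD : D -> tens D D).
Variables (C : bimodType A A) (DeltaC : C -> tens C C).
Hypotheses (DeltaD_lin : bimod_linear DeltaD) (DeltaC_lin : bimod_linear DeltaC).

Lemma bicomodule_eq (D' : bimodType B B) (DeltaD' : D' -> tens D' D')
    (C' : bimodType A A) (DeltaC' : C' -> tens C' C') (M : bimodType B A)
    (lam lam' : M -> tens D' M) (rho rho' : M -> tens M C')
    ll rl lP rP cP ll' rl' lP' rP' cP' :
  lam =1 lam' -> rho =1 rho' ->
  @Bicomodule B A D' DeltaD' C' DeltaC' M lam rho ll rl lP rP cP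
  = @Bicomodule B A D' DeltaD' C' DeltaC' M lam' rho' ll' rl' lP' rP' cP'.
Proof.
move=> /funext el /funext er; subst lam' rho'.
by congr Bicomodule; apply: Prop_irrelevance.
Qed.

Definition bicomod_ext (X : bicomodule DeltaD DeltaC) :
  bicomodule (ext_comul DeltaD) (ext_comul DeltaC) :=
  Bicomodule (lext_bilinear (bicomod_lrho_lin X))
    (rext_bilinear (bicomod_rrho_lin X))
    ((lext_comoduleE DeltaD_lin _).2 (bicomod_lP X))
    ((rext_comoduleE DeltaC_lin _).2 (bicomod_rP X))
    ((ext_compatE (bicomod_lrho_lin X) (bicomod_rrho_lin X)).2
       (@bicomod_compat _ _ _ _ _ _ X)).

Lemma bicomod_isomorphic :
  isomorphic_categories (bicomod_cat DeltaD DeltaC)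
    (counital_bicomod_cat (ext_comul DeltaD) (@ext_counit B D)
       (ext_comul DeltaC) (@ext_counit A C)).
Proof.
set K := bicomod_cat _ _; set L := counital_bicomod_cat _ _ _ _.
pose P (Y : bicomod_cat (ext_comul DeltaD) (ext_comul DeltaC)) :=
  lcounital (@ext_counit B D) (@bicomod_lrho _ _ _ _ _ _ Y) /\
  rcounital (@ext_counit A C) (@bicomod_rrho _ _ _ _ _ _ Y).
pose F0 (X : K) : L := exist P (bicomod_ext X)
  (conj (lext_counital (@bicomod_lrho _ _ _ _ _ _ X))
        (rext_counital (@bicomod_rrho _ _ _ _ _ _ X))).
have homE (X X' : K) (f : X -> X') :
    bicolinear f <-> @bicolinear _ _ _ _ _ _ (bicomod_ext X) (bicomod_ext X') f.
  by split=> -[[fl el] [fr er]]; split; split=> //;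
     [apply/lext_natural | apply/rext_natural | apply/lext_natural
     | apply/rext_natural].
pose F1 (X X' : K) (f : hom X X') : hom (F0 X) (F0 X') :=
  exist _ (sval f) ((homE X X' _).1 (svalP f)).
have F1id X : F1 X X (idm X) = idm (F0 X) by apply: eq_exist.
have F1comp X Y Z (g : hom Y Z) (f : hom X Y) :
    F1 _ _ (comp g f) = comp (F1 _ _ g) (F1 _ _ f) by apply: eq_exist.
(* Counitality on both sides recovers the coactions of [Y] from [lres] and [rres]; coassociativity
   and compatibility of the latter thereby reduce to the axioms of [Y]. *)
have lK (Y : L) := funext (lres_counital (svalP Y).1).
have rK (Y : L) := funext (rres_counital (svalP Y).2).
have llP (Y : L) := lres_bilinear (bicomod_lrho_lin (sval Y)).
have rrP (Y : L) := rres_bilinear (bicomod_rrho_lin (sval Y)).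
have lP (Y : L) : is_lcomodule DeltaD (lres (@bicomod_lrho _ _ _ _ _ _ (sval Y))).
  by apply/lext_comoduleE; rewrite // lK; apply: bicomod_lP.
have rP (Y : L) : is_rcomodule DeltaC (rres (@bicomod_rrho _ _ _ _ _ _ (sval Y))).
  by apply/rext_comoduleE; rewrite // rK; apply: bicomod_rP.
have cP (Y : L) m :
    tassoc (tmap (lres (@bicomod_lrho _ _ _ _ _ _ (sval Y))) id
                 (rres (@bicomod_rrho _ _ _ _ _ _ (sval Y)) m))
    = tmap id (rres (@bicomod_rrho _ _ _ _ _ _ (sval Y)))
           (lres (@bicomod_lrho _ _ _ _ _ _ (sval Y)) m).
  move: m; apply/(ext_compatE (llP Y) (rrP Y)).
  by rewrite lK rK; apply: bicomod_compat.
apply: (@fully_faithful_isomorphic K L (Functor F1id F1comp)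
  (fun Y => Bicomodule (llP Y) (rrP Y) (lP Y) (rP Y) (cP Y))) => /=.
- by move=> [M lam rho *]; apply: bicomodule_eq; [apply: lextE | apply: rextE].
- move=> [[M lam rho ? ? ? ? ?] [cul cur]]; apply: eq_exist; apply: bicomodule_eq => m.
    exact: lres_counital.
  exact: rres_counital.
- by move=> X X' [f fP] [g gP] /(congr1 sval) e; apply: eq_exist.
- move=> X X' [f fP]; exists (exist _ f ((homE X X' f).2 fP)).
  exact: eq_exist.
Qed.
End BicomoduleIsomorphism.

(** * The coring on [bold C] and its extension [hat C] *)

Lemma tlift_lact (B A : pzRingType) (M : bimodType B A) (N : lmodType A)
    (Z : zmodType) (h : M -> N -> Z) (b : B) (t : tens M N) : balanced h ->
  tlift h (b *: t) = tlift (fun m n => h (b *: m) n) t.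
Proof.
move=> hb; have [hl hr hs] := hb.
have hb' : balanced (fun m n => h (b *: m) n).
  by split=> [m m' n|m n n'|m a n]; rewrite ?scalerDr ?hl ?hr -?bimodA ?hs.
move: t; apply: tens_ext => [s t|s t|m n].
- by rewrite scalerDr tlift_additive.
- by rewrite tlift_additive.
- by rewrite scale_tpure !tliftE.
Qed.

Lemma tlift_ract (A B : pzRingType) (M : rmodType A) (N : bimodType A B)
    (Z : zmodType) (h : M -> N -> Z) (b : B) (t : tens M N) : balanced h ->
  tlift h (t :* b) = tlift (fun m n => h m (n :* b)) t.
Proof.
move=> hb; have [hl hr hs] := hb.
have hb' : balanced (fun m n => h m (n :* b)).
  by split=> [m m' n|m n n'|m a n]; rewrite ?ractDl ?hl ?hr ?bimodA ?hs.
move: t; apply: tens_ext => [s t|s t|m n].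
- by rewrite ractDl tlift_additive.
- by rewrite tlift_additive.
- by rewrite ract_tpure !tliftE.
Qed.

Section Bold.
Variables (R : comNzRingType) (C : coalgebra R).
Local Notation Delta := (comul C).
Local Notation boldC := (bold C).

Lemma bold_comulD : {morph @bold_comul R C : x y / x + y}.
Proof.
by move=> x y; rewrite /bold_comul -tlift_additive ?comulD //;
   apply: bold_tpure_balanced.
Qed.

(** In Sweedler notation both sides are [f(c1) c2 (x) c3], bracketed to the right on one side and to
    the left on the other; coassociativity of [C] identifies them. *)
Lemma bold_comul_lscale (f : bullet C) (c : boldC) :
  bold_comul (f *: c) = f *: bold_comul c.
Proof.
have hb := bold_tpure_balanced C; have [hl hr hs] := hb.
rewrite -[f *: c]/(lharp f c) /lharp.
rewrite (@tlift_comp _ _ _ _ _ (@bold_comul R C)); last exact: bold_comulD.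
transitivity (tlift (fun x b : C => tlift (fun y z : C =>
    tpure boldC boldC ((f x : R) *: y : C) z) (Delta b)) (Delta c)).
  by apply: eq_tlift => x b; rewrite /bold_comul comulZ tlift_lact.
rewrite -sweedler3.
- rewrite /bold_comul (@tlift_comp _ _ _ _ _ (fun t => f *: t)); last exact: scalerDr.
  apply: eq_tlift => a z; rewrite scale_tpure.
  rewrite -[f *: (a : boldC)]/(lharp f a) /lharp.
  by rewrite (@tlift_comp _ _ _ _ _ (fun u : C => tpure boldC boldC u z)).
- move=> z; split=> [m m' n|m n n'|m r n].
  + by rewrite bulletD scalerDl hl.
  + by rewrite scalerDr hl.
  + by rewrite bulletZr scalerA.
- move=> x; split=> [m m' n|m n n'|m r n].
  + by rewrite scalerDr hl.
  + by rewrite hr.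
  + by rewrite -hs bimodA.
Qed.

(** Likewise, both sides are [c1 (x) c2 f(c3)] with the two bracketings. *)
Lemma bold_comul_rscale (f : bullet C) (c : boldC) :
  bold_comul (c :* f) = bold_comul c :* f.
Proof.
have hb := bold_tpure_balanced C; have [hl hr hs] := hb.
rewrite -[c :* f]/(rharp c f) /rharp.
rewrite (@tlift_comp _ _ _ _ _ (@bold_comul R C)); last exact: bold_comulD.
transitivity (tlift (fun a z : C => tlift (fun x y : C =>
    tpure boldC boldC x (y :* (f z : R) : C)) (Delta a)) (Delta c)).
  by apply: eq_tlift => a z; rewrite /bold_comul comulZr tlift_ract.
rewrite sweedler3.
- rewrite /bold_comul (@tlift_comp _ _ _ _ _ (fun t => t :* f)); last exact: ractDl.
  apply: eq_tlift => x b; rewrite ract_tpure.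
  rewrite -[(b : boldC) :* f]/(rharp b f) /rharp.
  by rewrite (@tlift_comp _ _ _ _ _ (fun u : C => tpure boldC boldC x u)).
- move=> z; split=> [m m' n|m n n'|m r n].
  + by rewrite hl.
  + by rewrite ractDl hr.
  + by rewrite hs bimodA.
- move=> x; split=> [m m' n|m n n'|m r n].
  + by rewrite ractDl hr.
  + by rewrite bulletD ractDr hr.
  + by rewrite bulletZ ractA.
Qed.

Lemma bold_comul_bilinear : bimod_linear (@bold_comul R C).
Proof.
by split=> f x y; rewrite bold_comulD (bold_comul_lscale, bold_comul_rscale).
Qed.

(** Both sides are the image of [c1 (x) c2 (x) c3] in the triple tensor product over [bullet C]. *)
Lemma bold_comul_coassoc : coassociative (@bold_comul R C).
Proof.
have hb := bold_tpure_balanced C; have [hl hr hs] := hb.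
have [bl br] := bold_comul_bilinear.
have [pl pr ps] := tpure_balanced boldC (tens boldC boldC).
have [ql qr qs] := tpure_balanced (tens boldC boldC) boldC.
move=> c; rewrite {2 4}/bold_comul.
rewrite (@tlift_comp _ _ _ _ _ (tmap (@bold_comul R C) id)); last exact: tmap_additive.
rewrite (@tlift_comp _ _ _ _ _ (tmap id (@bold_comul R C))); last exact: tmap_additive.
rewrite tlift_comp; last exact: tassoc_additive.
transitivity (tlift (fun a z : C => tlift (fun x y : C =>
    tpure boldC (tens boldC boldC) x (tpure boldC boldC y z)) (Delta a)) (Delta c)).
  apply: eq_tlift => a z; rewrite tmapE // /bold_comul.
  rewrite (@tlift_comp _ _ _ _ _ (fun t => tpure (tens boldC boldC) boldC t z)) //.
  rewrite tlift_comp; last exact: tassoc_additive.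
  by apply: eq_tlift => x y; apply: tassocE.
rewrite sweedler3.
- apply: eq_tlift => x b; rewrite tmapE // /bold_comul.
  by rewrite (@tlift_comp _ _ _ _ _ (fun t => tpure boldC (tens boldC boldC) x t)).
- move=> z; split=> [m m' n|m n n'|m r n].
  + by rewrite pl.
  + by rewrite hl pr.
  (* Scalars of [R] act on [bold C] through [eta], so balancedness over [R] is an instance of
     balancedness over [bullet C]. *)
  + by rewrite -eta_rharp ps scale_tpure eta_lharp.
- by move=> x; split=> [m m' n|m n n'|m r n]; rewrite ?hl ?hr ?hs ?pr.
Qed.

(** [hat_comul] maps [Delta c] to [hat (x) hat] directly, [ext_comul] by way of [bold (x) bold]; on
    pure tensors both give [(x, 0) (x) (y, 0)]. Through this equation the results on [ext] apply to
    [hat]. *)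
Lemma hat_comulE : @hat_comul R C = ext_comul (@bold_comul R C).
Proof.
have [il ir] := ext_in_bilinear boldC.
apply: funext => -[c f]; rewrite /hat_comul /ext_comul tlift_comp.
  do 3!congr (_ + _); apply: eq_tlift => x y; exact/esym/tmapE.
exact: tmap_additive.
Qed.

Definition eta_morphism : alg_morphism (base_algebra R) (bullet_algebra C) :=
  @AlgMorphism R (base_algebra R) (bullet_algebra C) (@eta R C) (fun=> erefl).

(** Bilinearity holds because [eta r] acts on [bold C] as [r] does on [C]. For the
    comultiplications, [restr_chi] after [tmap id id] is the canonical map that defines
    [bold_comul]. *)
Lemma eta_coring_morphism :
  @is_coring_morphism R (base_algebra R) (bullet_algebra C)
    C Delta boldC (@bold_comul R C) eta_morphism id.
Proof.
split.
  split=> r x y; congr (_ + _); [exact/esym/eta_lharp | exact/esym/eta_rharp].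
move=> c; rewrite /tmap tlift_comp; last first.
  apply: tlift_additive; have [hl hr hs] := tpure_balanced boldC boldC.
  by split=> [m m' n|m n n'|m a n]; [apply: hl | apply: hr | apply: hs].
by apply: eq_tlift => x y; apply: (@restr_chiE _ _ (@eta R C) boldC).
Qed.
End Bold.

Theorem proposition3p2 (R : comNzRingType) (C : coalgebra R) :
  (is_coring (@bold_comul R C) /\
   exists g : alg_morphism (base_algebra R) (bullet_algebra C),
     (forall r, g r = eta C r) /\
     @is_coring_morphism R (base_algebra R) (bullet_algebra C)
       C (comul C) (bold C) (@bold_comul R C) g id) /\
  is_counital_coring (@hat_comul R C) (@hat_counit R C) /\
  (isomorphic_categories
     (rcomod_cat (@bold_comul R C))
     (counital_rcomod_cat (@hat_comul R C) (@hat_counit R C)) /\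
   isomorphic_categories
     (lcomod_cat (@bold_comul R C))
     (counital_lcomod_cat (@hat_comul R C) (@hat_counit R C))) /\
  forall D : coalgebra R,
    isomorphic_categories
      (bicomod_cat (@bold_comul R D) (@bold_comul R C))
      (counital_bicomod_cat (@hat_comul R D) (@hat_counit R D)
                            (@hat_comul R C) (@hat_counit R C)).
Proof.
have Cl := bold_comul_bilinear C; have Ca := @bold_comul_coassoc R C.
split; [|split; [|split; [split|]]].
- split; first by split.
  by exists (eta_morphism C); split=> //; apply: eta_coring_morphism.
- rewrite hat_comulE; split; last exact: ext_counitP.
  by split; [apply: ext_comul_bilinear | apply: ext_comul_coassoc].
- by rewrite hat_comulE; apply: rcomod_isomorphic.
- by rewrite hat_comulE; apply: lcomod_isomorphic.
- move=> D; rewrite !hat_comulE; apply: bicomod_isomorphic => //.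
  exact: bold_comul_bilinear.
Qed.
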